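(* Let $K$ be a compact Hausdorff space and let $\mathcal{H}$ be a real Hilbert space whose dimension is even or infinite. Then the real Banach space $C(K,\mathcal{H})$ satisfies the Mazur--Ulam property.
   Context: $C(K,\mathcal{H})$ is the Banach space of all continuous functions from $K$ to $\mathcal{H}$, with the supremum norm. For a Banach space $X$, $S(X)$ denotes its unit sphere. A Banach space $X$ satisfies the Mazur--Ulam property if for every (real) Banach space $Y$, every surjective isometry $\Delta:S(X)\to S(Y)$ (a map preserving the distances induced by the norms) admits an extension to a surjective real linear isometry from $X$ onto $Y$. *)

(* Defs.v *)
From HB Require Import structures.
From mathcomp Require Import all_boot all_order all_algebra.
From mathcomp Require Import all_classical all_reals all_analysis.
From mathcomp Require Import ring.

Set Implicit Arguments.
Unset Strict Implicit.
Unset Printing Implicit Defensive.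

Import Order.TTheory GRing.Theory Num.Theory.
Import numFieldNormedType.Exports.

Local Open Scope classical_set_scope.
Local Open Scope ring_scope.

(* The compactness proof is an argument of the type, because the supremum norm
   is finite (and so the instances below exist) only for compact K. *)
Definition contfun (R : realType) (K : topologicalType)
    (cK : compact [set: K]) (H : normedModType R) : Type :=
  continuousType K H.

Section contfun_lmodule.
Context (R : realType) (K : topologicalType) (cK : compact [set: K])
  (H : normedModType R).
Local Notation C := (contfun cK H).

HB.instance Definition _ := Choice.copy C (continuousType K H).

Definition contfun_fun (f : C) : K -> H := f : continuousType K H.
Local Coercion contfun_fun : contfun >-> Funclass.

Definition contfun_pack (f : K -> H) (fc : continuous f) : C :=
  (mkcts fc : continuousType K H).

Lemma contfun_continuous (f : C) : continuous f.
Proof. exact: (@cts_fun _ _ f). Qed.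

Lemma contfun_ext (f g : C) : (forall x, f x = g x) -> f = g.
Proof. by move=> fg; apply/continuousEP. Qed.

Lemma contfun_zero_subproof : continuous (fun _ : K => 0 : H).
Proof. by move=> x; exact: cvg_cst. Qed.

Lemma contfun_opp_subproof (f : C) : continuous (fun x => - f x).
Proof. by move=> x; apply: cvgN; exact: contfun_continuous. Qed.

Lemma contfun_add_subproof (f g : C) : continuous (fun x => f x + g x).
Proof. by move=> x; apply: cvgD; exact: contfun_continuous. Qed.

Lemma contfun_scale_subproof (a : R) (f : C) : continuous (fun x => a *: f x).
Proof. by move=> x; apply: cvgZr; exact: contfun_continuous. Qed.

Definition contfun_zero : C := contfun_pack contfun_zero_subproof.
Definition contfun_opp (f : C) : C := contfun_pack (@contfun_opp_subproof f).
Definition contfun_add (f g : C) : C := contfun_pack (@contfun_add_subproof f g).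
Definition contfun_scale (a : R) (f : C) : C :=
  contfun_pack (@contfun_scale_subproof a f).

Lemma contfun_addA : associative contfun_add.
Proof. by move=> f g h; apply: contfun_ext => x; exact: addrA. Qed.
Lemma contfun_addC : commutative contfun_add.
Proof. by move=> f g; apply: contfun_ext => x; exact: addrC. Qed.
Lemma contfun_add0 : left_id contfun_zero contfun_add.
Proof. by move=> f; apply: contfun_ext => x; exact: add0r. Qed.
Lemma contfun_addN : left_inverse contfun_zero contfun_opp contfun_add.
Proof. by move=> f; apply: contfun_ext => x; exact: addNr. Qed.

HB.instance Definition _ := GRing.isZmodule.Build C
  contfun_addA contfun_addC contfun_add0 contfun_addN.

Lemma contfun_scaleA a b (f : C) :
  contfun_scale a (contfun_scale b f) = contfun_scale (a * b) f.
Proof. by apply: contfun_ext => x; exact: scalerA. Qed.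
Lemma contfun_scale1 : left_id 1 contfun_scale.
Proof. by move=> f; apply: contfun_ext => x; exact: scale1r. Qed.
Lemma contfun_scaleDr : right_distributive contfun_scale +%R.
Proof. by move=> a f g; apply: contfun_ext => x; exact: scalerDr. Qed.
Lemma contfun_scaleDl (f : C) : {morph contfun_scale^~ f : a b / a + b}.
Proof. by move=> a b; apply: contfun_ext => x; exact: scalerDl. Qed.

HB.instance Definition _ := GRing.Zmodule_isLmodule.Build R C
  contfun_scaleA contfun_scale1 contfun_scaleDr contfun_scaleDl.

(* If K is empty this is sup set0 = 0. *)
Definition contfun_norm (f : C) : R := sup [set `|f x| | x in [set: K]].

Lemma contfun_norm_has_ub (f : C) : has_ubound [set `|f x| | x in [set: K]].
Proof.
have : compact [set `|f x| | x in [set: K]].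
  apply: (@continuous_compact _ _ (fun x => `|f x|)) => //.
  apply: continuous_subspaceT => x.
  by apply: cvg_norm; exact: contfun_continuous.
move=> /compact_bounded[M [_ /(_ (M + 1))]].
rewrite ltrDl ltr01 => /(_ isT) MB; exists (M + 1) => _ [x _ <-].
by rewrite -[leLHS]normr_id; apply: (MB `|f x|); exists x.
Qed.

Lemma contfun_norm_ub (f : C) x : `|f x| <= contfun_norm f.
Proof. by apply: ub_le_sup; [exact: contfun_norm_has_ub|exists x]. Qed.

Lemma contfun_norm_le (f : C) (M : R) :
  0 <= M -> (forall x, `|f x| <= M) -> contfun_norm f <= M.
Proof.
move=> M0 fM; rewrite /contfun_norm.
have [->|/set0P ne] := eqVneq [set `|f x| | x in [set: K]] set0.
  by rewrite sup0.
by apply: ge_sup => // _ [x _ <-].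
Qed.

Lemma contfun_norm_ge0 (f : C) : 0 <= contfun_norm f.
Proof.
rewrite /contfun_norm.
have [->|/set0P[_ [x _ _]]] := eqVneq [set `|f x| | x in [set: K]] set0.
  by rewrite sup0.
exact: le_trans (contfun_norm_ub f x).
Qed.

Lemma contfun_normD (f g : C) :
  contfun_norm (f + g) <= contfun_norm f + contfun_norm g.
Proof.
apply: contfun_norm_le => [|x]; first by rewrite addr_ge0 ?contfun_norm_ge0.
apply: (le_trans (ler_normD (f x) (g x))).
by rewrite lerD ?contfun_norm_ub.
Qed.

Lemma contfun_normZ (a : R) (f : C) :
  contfun_norm (a *: f) = `|a| * contfun_norm f.
Proof.
have le1 b (g : C) : contfun_norm (b *: g) <= `|b| * contfun_norm g.
  apply: contfun_norm_le => [|x]; first by rewrite mulr_ge0 ?contfun_norm_ge0.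
  by rewrite (normrZ b (g x)) ler_wpM2l ?contfun_norm_ub.
apply/eqP; rewrite eq_le le1 /=.
have [->|a0] := eqVneq a 0; first by rewrite normr0 mul0r contfun_norm_ge0.
rewrite -ler_pdivlMl ?normr_gt0// -normfV.
by apply: le_trans (le1 _ _); rewrite scalerA mulVf// scale1r.
Qed.

Lemma contfun_norm0_eq0 (f : C) : contfun_norm f = 0 -> f = 0.
Proof.
move=> f0; apply: contfun_ext => x.
by apply/eqP; rewrite -normr_le0 -f0 contfun_norm_ub.
Qed.

HB.instance Definition _ := Lmodule_isNormed.Build R C
  contfun_normD contfun_normZ contfun_norm0_eq0.

Lemma contfun_normE (f : C) : `|f| = sup [set `|f x| | x in [set: K]].
Proof. by []. Qed.

End contfun_lmodule.
Coercion contfun_fun : contfun >-> Funclass.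

Section contfun_complete.
Context (R : realType) (K : topologicalType) (cK : compact [set: K])
  (H : completeNormedModType R).
Local Notation C := (contfun cK H).

Lemma contfun_cauchy_cvg (F : set_system C) :
  ProperFilter F -> cauchy F -> cvg F.
Proof.
move=> FF Fc.
have Fe (e : R) : 0 < e -> exists f : C, F [set g | `|f - g| < e].
  move=> e0; have /cauchyP/(_ e e0)[f] := Fc.
  by rewrite -ball_normE; exists f.
pose ev (x : K) (f : C) : H := f x.
have evc x : cvg (ev x @ F).
  apply: cauchy_cvg; apply: cauchy_exP => e e0.
  have [f Ff] := Fe e e0; exists (f x); rewrite /= nbhs_simpl /=.
  apply: filterS Ff => g /=; rewrite -ball_normE /=; apply: le_lt_trans.
  exact: (contfun_norm_ub (f - g) x).
pose l (x : K) : H := lim (ev x @ F).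
have lu (e : R) (f : C) : F [set g | `|f - g| < e] ->
    forall x, `|f x - l x| <= e.
  move=> Ff x.
  have fl : (fun g : C => `|f x - g x|) @ F --> `|f x - l x|.
    by apply: cvg_norm; apply: cvgB; [exact: cvg_cst|exact: evc].
  apply: (@closed_cvg _ _ F _ _ (fun r : R => r <= e) _ _ _ fl).
    exact: closed_le.
  apply: filterS Ff => g /= /ltW; apply: le_trans.
  exact: (contfun_norm_ub (f - g) x).
have lc : continuous l.
  move=> x; apply/cvgrPdist_lt => e e0.
  have e3 : 0 < e / 3 by rewrite divr_gt0.
  have [f /lu fl] := Fe _ e3.
  have /cvgrPdist_lt/(_ _ e3) := @contfun_continuous _ _ _ _ f x.
  apply: filterS => y fxy.
  have -> : e = e / 3 + (e / 3 + e / 3) by field.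
  apply: le_lt_trans (ler_distD (f x) (l x) (l y)) _.
  rewrite [`|l x - f x|]distrC ler_ltD ?fl//.
  apply: le_lt_trans (ler_distD (f y) (f x) (l y)) _.
  by rewrite ltr_leD ?fl.
apply/cvg_ex; exists (contfun_pack cK lc : C).
apply/cvgrPdist_le => /= e e0.
have e2 : 0 < e / 2 by rewrite divr_gt0.
have [f Ff] := Fe _ e2.
apply: filterS (Ff) => g /= fg.
apply: contfun_norm_le => [|x]; first exact: ltW.
rewrite [e]splitr; apply: le_trans (ler_distD (f x) (l x) (g x)) _.
rewrite lerD//; first by rewrite distrC lu.
apply: le_trans (ltW fg).
exact: (contfun_norm_ub (f - g) x).
Qed.

HB.instance Definition _ := Uniform_isComplete.Build C contfun_cauchy_cvg.

End contfun_complete.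

Definition unit_sphere (R : realType) (X : normedModType R) : set X :=
  [set x | `|x| = 1].
Arguments unit_sphere {R} X.

(* A map between the spheres is represented by a map [Delta : X -> Y] between
   the ambient spaces, whose values off the unit sphere of [X] are irrelevant. *)
Definition mazur_ulam_property (R : realType) (X : completeNormedModType R) :=
  forall (Y : completeNormedModType R) (Delta : X -> Y),
    set_fun (unit_sphere X) (unit_sphere Y) Delta ->
    set_surj (unit_sphere X) (unit_sphere Y) Delta ->
    (forall x y, unit_sphere X x -> unit_sphere X y ->
      `|Delta x - Delta y| = `|x - y|) ->
  exists T : {linear X -> Y},
    [/\ forall x y, `|T x - T y| = `|x - y|,
        set_surj [set: X] [set: Y] T &
        forall x, unit_sphere X x -> T x = Delta x].

Definition has_dimension (R : realType) (V : lmodType R) (n : nat) : Prop :=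
  exists e : 'I_n -> V,
    (forall c : 'I_n -> R, \sum_(i < n) c i *: e i = 0 -> forall i, c i = 0) /\
    (forall v : V, exists c : 'I_n -> R, v = \sum_(i < n) c i *: e i).

(* Hamel bases: finite Hilbert dimension n means algebraic dimension n, and
   infinite Hilbert dimension means that there is no finite basis. *)
Definition even_dimensional (R : realType) (V : lmodType R) : Prop :=
  exists2 n : nat, ~~ odd n & has_dimension V n.

Definition infinite_dimensional (R : realType) (V : lmodType R) : Prop :=
  forall n : nat, ~ has_dimension V n.

(* Main.v *)
(* Let D be a surjective isometry from the unit sphere of C(K, H) onto that of
   Y, and for t in K and |e| = 1 let F(t, e) be the set of norm one functions with
   value e at t.  D maps F(t, e) onto a convex subset of the sphere of Y, so that
   by Hahn-Banach some functional f of norm one is 1 on D (F(t, e)); since D maps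
   F(t, - e) onto - D (F(t, e)), comparing distances to these two faces gives
     1 - |e - x t| <= f (D x) <= |e + x t| - 1.                            (i)
   The point is that f (D x) = <x t, e> for all x.  If x attains its norm at some
   s <> t, the midpoint of D x and D y, where y is x killed near t, comes from a
   function z in the same face at s, and strict convexity of H forces
   z t = x t / 2 and f (D z) = f (D x) / 2.  Iterating, (i) is only needed for
   x t -> 0, where both its sides agree with <x t, e> up to second order.  The
   remaining x are limits of such functions if t is not isolated, and inner
   points of segments with such endpoints on which D is affine if t is isolated
   in a larger K.  If K is a point, the sphere of Y satisfies the rhombus law
   |u + v|^2 + |u - v|^2 = 4, and Y is a Hilbert space by a theorem of Day.
   Finally, the functionals f separate the points of Y, so that the homogeneous
   extension of D is linear. *)

Require Import Defs.
From HB Require Import structures.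
From mathcomp Require Import all_boot all_order all_algebra.
From mathcomp Require Import all_classical all_reals all_analysis.
From mathcomp Require Import ring lra.

Set Implicit Arguments.
Unset Strict Implicit.
Unset Printing Implicit Defensive.

Import Order.TTheory GRing.Theory Num.Theory.
Import numFieldNormedType.Exports.

Local Open Scope classical_set_scope.
Local Open Scope ring_scope.

(** * The Hahn-Banach theorem *)

(** Homogeneity is asked only as an inequality for [0 < c], the form that passes to infima; the
    inverse scalar turns it into an equality. *)
Definition sublinear (R : realType) (V : lmodType R) (p : V -> R) :=
  (forall x y, p (x + y) <= p x + p y) /\
  (forall c x, 0 < c -> p (c *: x) <= c * p x).

Section hahn_banach.
Context (R : realType) (V : lmodType R).
Implicit Types (p q : V -> R).

Lemma sublinear0 p : sublinear p -> p 0 = 0.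
Proof.
move=> [_ pZ].
have := pZ 2 0 ltac:(by rewrite ltr0n).
have := pZ 2^-1 0 ltac:(by rewrite invr_gt0 ltr0n).
by rewrite !scaler0; lra.
Qed.

Lemma sublinear_opp p x : sublinear p -> - p (- x) <= p x.
Proof.
by move=> sp; have := sp.1 x (- x); rewrite subrr (sublinear0 sp); lra.
Qed.

Lemma sublinearZ p c x : sublinear p -> 0 < c -> p (c *: x) = c * p x.
Proof.
move=> [_ pZ] c0; apply/eqP; rewrite eq_le pZ//=.
have := pZ c^-1 (c *: x); rewrite invr_gt0 scalerA mulVf ?gt_eqF// scale1r.
by move=> /(_ c0); rewrite ler_pdivlMl.
Qed.

Lemma sublinear_odd_scalar p : sublinear p -> (forall x, p (- x) = - p x) ->
  exists f : {scalar V}, forall x, f x = p x.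
Proof.
move=> sp po.
have pD x y : p (x + y) = p x + p y.
  apply/eqP; rewrite eq_le sp.1/=.
  by have := sp.1 (- x) (- y); rewrite -opprD !po; lra.
have pZ c x : p (c *: x) = c * p x.
  have [c0|c0|->] := ltgtP c 0; last by rewrite scale0r (sublinear0 sp) mul0r.
    have : p (- (c *: x)) = (- c) * p x.
      by rewrite -scaleNr sublinearZ// oppr_gt0.
    by rewrite po; lra.
  exact: sublinearZ.
have pl : linear_for *%R p by move=> c x y; rewrite pD pZ.
pose g := HB.pack_for {scalar V} p (GRing.isLinear.Build R V R *%R p pl).
by exists g.
Qed.

(** The pointwise infimum is finite because every [q] in the chain satisfies [- p (- x) <= q x]. For
    subadditivity, the smaller of [q] and [r] serves both summands. *)
Lemma sublinear_chain_inf (A : set (V -> R)) p :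
  sublinear p -> A !=set0 ->
  (forall q, A q -> sublinear q /\ forall x, q x <= p x) ->
  (forall q r, A q -> A r -> (forall x, q x <= r x) \/ (forall x,
    r x <= q x)) ->
  exists m, [/\ sublinear m, forall x, m x <= p x &
    forall q, A q -> forall x, m x <= q x].
Proof.
move=> sp [q0 Aq0] Ap At.
pose m x := inf [set q x | q in A].
have Ax x : [set q x | q in A] !=set0 by exists (q0 x), q0.
have lbA x : has_lbound [set q x | q in A].
  exists (- p (- x)) => _ [q Aq <-].
  have [sq qp] := Ap _ Aq.
  by apply: le_trans (sublinear_opp x sq); rewrite lerN2.
have mle q x : A q -> m x <= q x by move=> Aq; apply: ge_inf => //; exists q.
have lem x c : (forall q, A q -> c <= q x) -> c <= m x.
  by move=> h; apply: lb_le_inf => // _ [q Aq <-]; exact: h.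
exists m; split => [|x|q Aq x]; last exact: mle.
- split=> [x y|c x c0].
    rewrite -lerBlDr; apply/lem => q Aq; rewrite lerBlDr -lerBlDl.
    apply/lem => r Ar; rewrite lerBlDl.
    have [qr|rq] := At _ _ Aq Ar.
      apply: (le_trans (mle q _ Aq)); apply: (le_trans ((Ap _ Aq).1.1 x y)).
      by rewrite lerD2l.
    apply: (le_trans (mle r _ Ar)); apply: (le_trans ((Ap _ Ar).1.1 x y)).
    by rewrite lerD2r.
  rewrite -ler_pdivrMl//; apply/lem => q Aq; rewrite ler_pdivrMl//.
  by apply: (le_trans (mle q _ Aq)); exact: (Ap _ Aq).1.2.
- exact: le_trans (mle _ _ Aq0) ((Ap _ Aq0).2 x).
Qed.

(* The candidate [inf_(s >= 0) q (x + s y) - s q y] lies below [q], so that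
   it equals a minimal [q]; evaluating it at [x = - y], [s = 1] gives
   [q (- y) <= - q y]. *)
Lemma minimal_sublinear_odd q : sublinear q ->
  (forall r, sublinear r -> (forall x, r x <= q x) -> forall x, q x <= r x) ->
  forall y, q (- y) = - q y.
Proof.
move=> sq qmin y.
pose S x := [set q (x + s *: y) - s * q y | s in [set s : R | 0 <= s]].
pose r x := inf (S x).
have Sx x : S x !=set0 by exists (q (x + 0 *: y) - 0 * q y), 0 => /=.
have lbS x : has_lbound (S x).
  exists (- q (- x)) => _ [s s0 <-].
  have [->|s1] := eqVneq s 0.
    by rewrite scale0r addr0 mul0r subr0 sublinear_opp.
  have := sq.1 (x + s *: y) (- x); rewrite addrAC subrr add0r sublinearZ//.
    by lra.
  by rewrite lt_neqAle eq_sym s1.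
have rle s x : 0 <= s -> r x <= q (x + s *: y) - s * q y.
  by move=> s0; apply: ge_inf => //; exists s.
have ler x c : (forall s, 0 <= s -> c <= q (x + s *: y) - s * q y) -> c <= r x.
  by move=> h; apply: lb_le_inf => // _ [s s0 <-]; exact: h.
have rq x : r x <= q x.
  by have := rle 0 x (lexx _); rewrite scale0r addr0 mul0r subr0.
have sr : sublinear r.
  split=> [u v|c u c0].
    rewrite -lerBlDr; apply/ler => s s0; rewrite lerBlDr -lerBlDl.
    apply/ler => s' s'0; rewrite lerBlDl.
    apply: (le_trans (rle (s + s') _ (addr_ge0 s0 s'0))).
    have -> : u + v + (s + s') *: y = (u + s *: y) + (v + s' *: y).
      by rewrite scalerDl addrACA.
    by have := sq.1 (u + s *: y) (v + s' *: y); lra.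
  rewrite -ler_pdivrMl//; apply/ler => s s0; rewrite ler_pdivrMl//.
  apply: (le_trans (rle (c * s) _ (mulr_ge0 (ltW c0) s0))).
  by rewrite -scalerA -scalerDr sublinearZ// mulrBr mulrA.
have := qmin r sr rq (- y); have := rle 1 (- y) ler01.
rewrite scale1r addNr (sublinear0 sq) mul1r sub0r => h1 h2.
apply/eqP; rewrite eq_le (le_trans h2 h1)/=.
by have := sublinear_opp y sq; lra.
Qed.

(** Zorn's lemma for the reversed order yields a minimal sublinear functional below [p]; minimality
    makes it odd, and an odd sublinear functional is linear. *)
Lemma hahn_banach p : sublinear p ->
  exists f : {scalar V}, forall x, f x <= p x.
Proof.
move=> sp.
pose T := {q : V -> R | sublinear q /\ forall x, q x <= p x}.
pose t0 : T := exist _ p (conj sp (fun x => lexx _)).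
pose below (q r : T) := `[< forall x, sval r x <= sval q x >].
have [||A At|t tmin] := @ZL_preorder T t0 below.
- by move=> t; apply/asboolP.
- move=> q r s /asboolP rq /asboolP sq; apply/asboolP => x.
  exact: le_trans (rq x).
- have [[a Aa]|A0] := pselect (A !=set0); last first.
    by exists t0 => s As; exfalso; apply: A0; exists s.
  have [||||m [sm mp mA]] := @sublinear_chain_inf [set sval q | q in A] p.
  + exact: sp.
  + by exists (sval a), a.
  + by move=> _ [q Aq <-]; exact: (svalP q).
  + move=> _ _ [q Aq <-] [r Ar <-].
    by have [/asboolP h|/asboolP h] := At _ _ Aq Ar; [right|left].
  exists (exist _ m (conj sm mp)) => s As; apply/asboolP => x /=.
  by apply: mA; exists s.
have [st tp] := svalP t.
have todd := @minimal_sublinear_odd (sval t) st.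
have [|f ft] := sublinear_odd_scalar st.
  apply: todd => r sr rt.
  have rp x : r x <= p x := le_trans (rt x) (tp x).
  have /asboolP := tmin (exist _ r (conj sr rp)) ltac:(by apply/asboolP).
  by [].
by exists f => x; rewrite ft.
Qed.

End hahn_banach.

(** * Day's theorem on the rhombus law *)

(** A triple encodes a symmetric 2 by 2 matrix with off-diagonal entry [M.1.2], so that
    [M.1.1 + M.2] is its trace. *)
Definition binary_form (R : realType) (M : R * R * R) (x y : R) : R :=
  M.1.1 * x ^+ 2 + M.1.2 * (2 * x * y) + M.2 * y ^+ 2.

Section day.
Context (R : realType) (Y : normedModType R).
Context (rhombus : forall u v : Y, `|u| = 1 -> `|v| = 1 ->
  `|u + v| ^+ 2 + `|u - v| ^+ 2 = 4).
Context (a b : Y).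
Context (ab_free : forall x y : R, x *: a + y *: b = 0 -> x = 0 /\ y = 0).

Let N2 x y : R := `|x *: a + y *: b| ^+ 2.
(** If the gap is nonnegative, the ellipse of [M] lies in the unit disc of the norm on the span of
    [a] and [b]. Zeros of the gap are called contacts. *)
Let gap M x y : R := binary_form M x y - N2 x y.
Let above M := forall x y, 0 <= gap M x y.

Let N2Z k x y : N2 (k * x) (k * y) = k ^+ 2 * N2 x y.
Proof.
by rewrite /N2 -!scalerA -scalerDr normrZ exprMn real_normK ?num_real.
Qed.

Let gapZ M k x y : gap M (k * x) (k * y) = k ^+ 2 * gap M x y.
Proof. by rewrite /gap N2Z /binary_form; ring. Qed.

(** A substitute for the inscribed ellipse of maximal area. The values at (1, 0), (0, 1), (1, 1) and
    (1, -1) confine the forms of bounded trace to a compact box. *)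
Lemma exists_min_trace : exists2 M, above M &
  forall M', above M' -> M.1.1 + M.2 <= M'.1.1 + M'.2.
Proof.
have fc (x y : R) : continuous (fun M : R * R * R => binary_form M x y).
  move=> M; apply: cvgD; [apply: cvgD|]; apply: cvgM; try exact: cvg_cst.
  - by apply: continuous_comp; exact: cvg_fst.
  - by apply: continuous_comp; [exact: cvg_fst|exact: cvg_snd].
  - exact: cvg_snd.
have cl : closed above.
  have -> : above = \bigcap_(p in [set: R * R])
      (fun M => binary_form M p.1 p.2) @^-1` [set z | N2 p.1 p.2 <= z].
    apply/seteqP; split=> [M h p _ /=|M h x y].
      by have := h p.1 p.2; rewrite subr_ge0.
    by rewrite subr_ge0; exact: (h (x, y) I).
  apply: closed_bigI => p _; apply: preimage_closed; last exact: closed_ge.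
  by move=> M _; exact: fc.
(* The trace of the form [2 |a|^2 x^2 + 2 |b|^2 y^2], which dominates the squared norm by the
   triangle inequality. *)
pose c0 : R := 2 * `|a| ^+ 2 + 2 * `|b| ^+ 2.
pose box := (`[0, c0]%classic `*` `[- c0, c0]%classic) `*` `[0,
  c0]%classic : set (R * R * R).
have cbox : compact (box `&` above).
  apply: compact_closedI => //.
  by do 2![apply: compact_setX; last exact: segment_compact];
    exact: segment_compact.
have M0 : above (2 * `|a| ^+ 2, 0, 2 * `|b| ^+ 2).
  move=> x y; rewrite subr_ge0 /N2 /binary_form/=.
  have : `|x *: a + y *: b| ^+ 2 <= (`|x| * `|a| + `|y| * `|b|) ^+ 2.
    by rewrite lerXn2r ?nnegrE ?addr_ge0 ?mulr_ge0// -!normrZ ler_normD.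
  move=> /le_trans; apply.
  have := sqr_ge0 (`|x| * `|a| - `|y| * `|b|).
  rewrite -(real_normK (num_real x)) -(real_normK (num_real y)).
  by rewrite !expr2; nra.
have inbox M : above M -> M.1.1 + M.2 <= c0 -> box M.
  move=> h tr.
  have h1 := h 1 0; have h2 := h 0 1; have h3 := h 1 1; have h4 := h 1 (-1).
  have := (sqr_ge0 `|1 *: a + 0 *: b|, sqr_ge0 `|0 *: a + 1 *: b|,
    sqr_ge0 `|1 *: a + 1 *: b|, sqr_ge0 `|1 *: a + (-1) *: b|).
  move: h1 h2 h3 h4;
    rewrite /gap /binary_form /N2 => h1 h2 h3 h4 [[[k1 k2] k3] k4].
  by split; [split|]; rewrite /= in_itv/=; apply/andP; split; lra.
have [||M] :=
  @compact_EVT_min _ R (fun M => M.1.1 + M.2) (box `&` above) _ cbox.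
- by exists (2 * `|a| ^+ 2, 0, 2 * `|b| ^+ 2); split => //; exact: inbox.
- apply: continuous_subspaceT => M; apply: cvgD; last exact: cvg_snd.
  by apply: continuous_comp; exact: cvg_fst.
- rewrite inE => -[Mb Ma] Mmin; exists M => // M' M'a.
  have [tr|/ltW tr] := leP (M'.1.1 + M'.2) c0.
    by apply: Mmin; rewrite inE; split => //; exact: inbox.
  apply: le_trans tr.
  by apply: (Mmin (2 * `|a| ^+ 2, 0, 2 * `|b| ^+ 2)); rewrite inE; split => //;
    exact: inbox.
Qed.

Let gap_continuous M x y z w :
  continuous (fun t : R => gap M (x + t * z) (y + t * w)).
Proof.
have lc u v : continuous (fun t : R => u + t * v).
  by move=> t; apply: cvgD; [exact: cvg_cst|apply: cvgM;
    [exact: cvg_id|exact: cvg_cst]].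
have sq (f : R -> R) : continuous f -> continuous (fun t => f t ^+ 2).
  by move=> cf t; apply: continuous_comp (cf t) (@exprn_continuous R 2 _).
move=> t; apply: cvgB.
  apply: cvgD; [apply: cvgD|]; (apply: cvgM; first exact: cvg_cst).
  - exact: (sq _ (lc x z)).
  - by apply: cvgM; [apply: cvgM; [exact: cvg_cst|exact: lc]|exact: lc].
  - exact: (sq _ (lc y w)).
apply: (sq (fun t => `|(x + t * z) *: a + (y + t * w) *: b|)) => {}t.
apply: cvg_norm; apply: cvgD; (apply: cvgZ; [exact: lc|exact: cvg_cst]).
Qed.

(* If all contacts lay on the line of (c, s), then subtracting a small multiple
   of (- s x + c y)^2 - (c x + s y)^2 / 2 would lower the trace. *)
Lemma two_contacts M : above M ->
    (forall M', above M' -> M.1.1 + M.2 <= M'.1.1 + M'.2) ->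
  exists x y z w, [/\ gap M x y = 0, gap M z w = 0 & x * w - y * z != 0].
Proof.
move=> aM minM; apply: contrapT => noc.
have [[c s]] : exists cs : R * R, 0 < cs.1 ^+ 2 + cs.2 ^+ 2 /\
    forall x y, gap M x y = 0 -> cs.1 * y - cs.2 * x = 0.
  have [[x [y [g0 xy]]]|nc] :=
      pselect (exists x y, gap M x y = 0 /\ (x, y) <> (0, 0)).
    exists (x, y); split => /= [|z w gzw].
      rewrite lt_neqAle addr_ge0 ?sqr_ge0// andbT eq_sym.
      apply/eqP => /eqP; rewrite paddr_eq0 ?sqr_ge0// !sqrf_eq0 => /andP[].
      by move=> /eqP x0 /eqP y0; apply: xy; rewrite x0 y0.
    apply: contrapT => /eqP d; apply: noc; exists x, y, z, w; split => //.
  exists (1, 0); split => /= [|x y gxy]; first by rewrite expr0n/= addr0 expr1n.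
  have [[-> ->]|xy] := pselect ((x, y) = (0, 0)); first by rewrite !mulr0 subr0.
  by exfalso; apply: nc; exists x, y.
rewrite /= => -[D0 onl].
set D := _ + _ in D0.
(* Up to scaling, these vectors run through all directions off the contact line. Where the
   subtracted form is positive, the parameter satisfies [t ^+ 2 < 2], so that a minimum over
   [[-2, 2]] suffices. *)
pose g t := gap M (- s + t * c) (c + t * s).
have g0 t : 0 < g t.
  rewrite lt_neqAle aM andbT eq_sym; apply/eqP => /onl.
  move=> h; have : D = 0 by rewrite /D -[RHS]h; ring.
  by move=> D00; rewrite D00 ltxx in D0.
have [|t0 _ t0min] := @EVT_min R g (-2) 2 ltac:(lra).
  by apply: continuous_subspaceT; exact: gap_continuous.
pose e := g t0 / D ^+ 2.
have e0 : 0 < e by rewrite divr_gt0 ?exprn_gt0.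
pose M' := (M.1.1 - e * (s ^+ 2 - c ^+ 2 / 2), M.1.2 + e * (3 / 2 * (s * c)),
            M.2 - e * (c ^+ 2 - s ^+ 2 / 2)).
have trM' : M'.1.1 + M'.2 = M.1.1 + M.2 - e * D / 2 by rewrite /M' /D /=; field.
have : above M'; last first.
  by move=> /minM; rewrite trM'; have : 0 < e * D; [rewrite mulr_gt0|lra].
move=> x y.
pose u := c * x + s * y; pose v := - s * x + c * y.
have -> : gap M' x y = gap M x y - e * (v ^+ 2 - u ^+ 2 / 2).
  by rewrite /gap /binary_form /M' /u /v /=; field.
(* Close to the contact line the modification does not lower the form; elsewhere the choice of [e]
   gives [e * v ^+ 2 <= gap M x y]. *)
have [uv|uv] := leP (v ^+ 2) (u ^+ 2 / 2).
  have := aM x y; have : e * (v ^+ 2 - u ^+ 2 / 2) <= 0; last lra.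
  by rewrite mulr_ge0_le0 ?subr_le0// ltW.
have v0 : v != 0.
  apply/eqP => v0; move: uv; rewrite v0 expr0n/=.
  by have := sqr_ge0 u; lra.
have Dn0 : D != 0 by rewrite gt_eqF.
have -> : x = v / D * (- s + u / v * c).
  rewrite mulrDr [v / D * (_ * _)]mulrA.
  have -> : v / D * (u / v) = u / D by field; apply/andP.
  by rewrite /u /v /D; field.
have -> : y = v / D * (c + u / v * s).
  rewrite mulrDr [v / D * (_ * _)]mulrA.
  have -> : v / D * (u / v) = u / D by field; apply/andP.
  by rewrite /u /v /D; field.
rewrite gapZ -/(g _).
have : (v / D) ^+ 2 * g t0 <= (v / D) ^+ 2 * g (u / v).
  rewrite ler_wpM2l ?sqr_ge0// t0min// in_itv/= -ler_norml.
  have v20 : 0 < v ^+ 2 by rewrite exprn_even_gt0.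
  have : (u / v) ^+ 2 <= 2 ^+ 2.
    by rewrite exprMn exprVn ler_pdivrMr//; lra.
  by rewrite -(real_normK (num_real (u / v))) ler_sqr ?nnegrE.
have -> : (v / D) ^+ 2 * g t0 = e * v ^+ 2 by rewrite /e; field.
by have : 0 <= e * u ^+ 2; [rewrite mulr_ge0 ?sqr_ge0 ?ltW|lra].
Qed.

(** The rhombus law for the norm and the parallelogram law for the form both give the sum 4, so the
    nonnegative gaps at the sum and at the difference add up to 0. *)
Lemma contact_add M x y z w : above M -> gap M x y = 0 -> gap M z w = 0 ->
  `|x *: a + y *: b| = 1 -> `|z *: a + w *: b| = 1 ->
  gap M (x + z) (y + w) = 0.
Proof.
move=> aM gxy gzw n1 n2.
have hp := aM (x + z) (y + w); have hm := aM (x - z) (y - w).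
have := rhombus n1 n2.
have -> : x *: a + y *: b + (z *: a + w *: b) = (x + z) *: a + (y + w) *: b.
  by rewrite !scalerDl addrACA.
have -> : x *: a + y *: b - (z *: a + w *: b) = (x - z) *: a + (y - w) *: b.
  by rewrite !scalerBl opprD addrACA.
rewrite -/(N2 _ _) -/(N2 (x - z) _) => h.
have e1 : binary_form M x y = 1.
  by move: gxy; rewrite /gap /N2 n1 expr1n => /eqP; rewrite subr_eq0 => /eqP.
have e2 : binary_form M z w = 1.
  by move: gzw; rewrite /gap /N2 n2 expr1n => /eqP; rewrite subr_eq0 => /eqP.
have e3 : binary_form M (x + z) (y + w) + binary_form M (x - z) (y - w) =
    2 * binary_form M x y + 2 * binary_form M z w.
  by rewrite /binary_form; ring.
apply/eqP; rewrite eq_le hp andbT.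
by move: hp hm h; rewrite /gap; lra.
Qed.

(* Otherwise a maximal gap between two consecutive contacts of the segment
   would contain the contact produced by [contact_add]. *)
Lemma contact_segment M x y z w t : above M ->
  gap M x y = 0 -> gap M z w = 0 -> x * w - y * z != 0 -> 0 <= t <= 1 ->
  gap M (x + t * (z - x)) (y + t * (w - y)) = 0.
Proof.
move=> aM gxy gzw d /andP[t0 t1].
pose f t := gap M (x + t * (z - x)) (y + t * (w - y)).
have fc : continuous f by exact: gap_continuous.
apply: contrapT => ft; rewrite -/(f t) in ft.
have fcl : closed (f @^-1` [set 0]).
  apply: preimage_closed; last exact: closed_eq.
  by move=> ? _; exact: fc.
have f0 : f 0 = 0 by rewrite /f !mul0r !addr0.
have f1 : f 1 = 0 by rewrite /f !mul1r ![_ + (_ - _)]addrC !subrK.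
have idc (A : set R) : {within A, continuous (id : R -> R)}.
  by apply: continuous_subspaceT => ?; exact: cvg_id.
(* [s] is the last contact up to [t], and [r] below is the first one from [t] on. *)
have [||s /set_mem[sI fs] smax] :=
    @compact_EVT_max _ R id (`[0, t]%classic `&` f @^-1` [set 0]) _ _ (idc _).
- by exists 0; split => //=; rewrite in_itv/= lexx.
- by apply: compact_closedI => //; exact: segment_compact.
have [||r /set_mem[rI fr] rmin] :=
    @compact_EVT_min _ R id (`[t, 1]%classic `&` f @^-1` [set 0]) _ _ (idc _).
- by exists 1; split => //=; rewrite in_itv/= lexx andbT.
- by apply: compact_closedI => //; exact: segment_compact.
move: sI rI; rewrite /= !in_itv/= => /andP[s0 st] /andP[tr r1].
have st' : s < t by rewrite lt_neqAle st andbT; apply/eqP => h; apply: ft;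
  rewrite -h.
have tr' : t < r by rewrite lt_neqAle tr andbT; apply/eqP => h; apply: ft;
  rewrite h.
pose n q := `|(x + q * (z - x)) *: a + (y + q * (w - y)) *: b|.
have n0 q : 0 < n q.
  rewrite /n normr_gt0; apply/eqP => /ab_free[h1 h2].
  move/eqP: d; apply.
  have -> : x * w - y * z =
    (x + q * (z - x)) * (w - y) - (y + q * (w - y)) * (z - x) by ring.
  by rewrite h1 h2 !mul0r subrr.
have nn q : n q != 0 by rewrite gt_eqF.
have contact q : f q = 0 ->
    gap M ((n q)^-1 * (x + q * (z - x))) ((n q)^-1 * (y + q * (w - y))) = 0.
  by move=> fq; rewrite gapZ -/(f q) fq mulr0.
have unit q : `|((n q)^-1 * (x + q * (z - x))) *: a +
                ((n q)^-1 * (y + q * (w - y))) *: b| = 1.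
  rewrite -!scalerA -scalerDr normrZ -/(n q) ger0_norm ?invr_ge0 ?ltW//.
  by rewrite mulVf.
have := contact_add aM (contact s fs) (contact r fr) (unit s) (unit r).
(* The sum of the normalised contacts at [s] and [r] is [k] times the point of the segment with
   parameter [q], a mean of [s] and [r] with positive weights. *)
pose k := (n s)^-1 + (n r)^-1.
have k0 : 0 < k by rewrite addr_gt0 ?invr_gt0.
pose q := ((n s)^-1 * s + (n r)^-1 * r) / k.
have qk : q * k = (n s)^-1 * s + (n r)^-1 * r by rewrite /q divfK ?gt_eqF.
have -> : (n s)^-1 * (x + s * (z - x)) + (n r)^-1 * (x + r * (z - x)) =
    k * (x + q * (z - x)).
  have -> : k * (x + q * (z - x)) = k * x + (q * k) * (z - x) by ring.
  by rewrite qk /k; ring.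
have -> : (n s)^-1 * (y + s * (w - y)) + (n r)^-1 * (y + r * (w - y)) =
    k * (y + q * (w - y)).
  have -> : k * (y + q * (w - y)) = k * y + (q * k) * (w - y) by ring.
  by rewrite qk /k; ring.
rewrite gapZ -/(f q) => /eqP; rewrite mulf_eq0 expf_eq0 /= gt_eqF//= => /eqP fq.
have sq : s < q.
  rewrite -(ltr_pM2r k0) qk /k.
  have : 0 < (n r)^-1 * (r - s) by rewrite mulr_gt0 ?invr_gt0// subr_gt0; lra.
  by lra.
have qr : q < r.
  rewrite -(ltr_pM2r k0) qk /k.
  have : 0 < (n s)^-1 * (r - s) by rewrite mulr_gt0 ?invr_gt0// subr_gt0; lra.
  by lra.
have [qt|tq] := leP q t.
  have := smax q; rewrite inE => /(_ _)/wrap[]; last by lra.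
  by split => //=; rewrite in_itv/= qt andbT; lra.
have := rmin q; rewrite inE => /(_ _)/wrap[]; last by lra.
by split => //=; rewrite in_itv/= (ltW tq)/=; lra.
Qed.

(** Two independent contacts and their negatives span four cones that cover the plane, and each cone
    consists of multiples of points of a segment of contacts. *)
Lemma day_rhombus : exists M, forall x y,
  `|x *: a + y *: b| ^+ 2 = binary_form M x y.
Proof.
have [M aM minM] := exists_min_trace; exists M => x y.
have [u [v [z [w [guv gzw d]]]]] := two_contacts aM minM.
suff : gap M x y = 0 by rewrite /gap => /eqP; rewrite subr_eq0 => /eqP.
pose D := u * w - v * z.
pose l := (x * w - y * z) / D; pose m := (u * y - v * x) / D.
have -> : x = l * u + m * z by rewrite /l /m /D; field.
have -> : y = l * v + m * w by rewrite /l /m /D; field.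
have cone u' v' z' w' p q : gap M u' v' = 0 -> gap M z' w' = 0 ->
    u' * w' - v' * z' != 0 -> 0 <= p -> 0 <= q ->
    gap M (p * u' + q * z') (p * v' + q * w') = 0.
  move=> g1 g2 d' p0 q0.
  have [pq|pq] := eqVneq (p + q) 0.
    have -> : p = 0 by lra.
    have -> : q = 0 by lra.
    by have := gapZ M 0 0 0; rewrite expr0n/= !mul0r !addr0.
  have -> : p * u' + q * z' = (p + q) * (u' + q / (p + q) * (z' - u')) by field.
  have -> : p * v' + q * w' = (p + q) * (v' + q / (p + q) * (w' - v')) by field.
  rewrite gapZ contact_segment ?mulr0// divr_ge0 ?addr_ge0//=.
  by rewrite ler_pdivrMr ?mul1r ?lerDr// lt_neqAle eq_sym pq addr_ge0.
have gN p q : gap M p q = 0 -> gap M (- p) (- q) = 0.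
  by move=> h; rewrite -(mulN1r p) -(mulN1r q) gapZ h mulr0.
have dN : - u * w - - v * z != 0 by rewrite !mulNr -opprD oppr_eq0.
have lm p q : 0 <= q -> gap M (p * u + q * z) (p * v + q * w) = 0.
  move=> q0; have [p0|p0] := leP 0 p; first exact: cone.
  rewrite -(mulrNN p u) -(mulrNN p v).
  by apply: cone; rewrite ?gN//; lra.
have [m0|m0] := leP 0 m; first exact: lm.
rewrite -[l * u + _]opprK -[l * v + _]opprK gN// !opprD.
rewrite -(mulNr l u) -(mulNr l v) -(mulNr m z) -(mulNr m w).
by apply: lm; rewrite oppr_ge0 ltW.
Qed.

End day.

(** * Isometries between unit spheres *)

Section normed_spheres.
Context (R : realType).
Implicit Types (X Y : normedModType R).

(** [x + y] is the sum of the points with parameters [m] and [1 - m]; both have norm at most 1, so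
    the norm 2 of their sum forces equality. *)
Lemma norm_segment X (x y : X) (m : R) : `|x| = 1 -> `|y| = 1 -> `|x + y| = 2 ->
  0 <= m <= 1 -> `|(1 - m) *: x + m *: y| = 1.
Proof.
move=> x1 y1 xy /andP[m0 m1].
have le1 n : 0 <= n -> n <= 1 -> `|(1 - n) *: x + n *: y| <= 1.
  move=> n0 n1; apply: le_trans (ler_normD _ _) _.
  by rewrite !normrZ x1 y1 !mulr1 !ger0_norm ?subr_ge0// subrK.
apply/eqP; rewrite eq_le le1//=.
have : `|x + y| <= `|(1 - m) *: x + m *: y| + `|(1 - (1 - m)) *: x + (1 - m) *:
  y|.
  apply: le_trans (ler_normD _ _); rewrite addrACA -!scalerDl.
  have -> : 1 - m + (1 - (1 - m)) = 1 by ring.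
  by rewrite subrKC !scale1r.
have := le1 (1 - m) ltac:(by rewrite subr_ge0) ltac:(by rewrite gerBl).
by rewrite xy; lra.
Qed.

(** [|x + p|] and [|y + p|] are at most 2, and a mean of them with positive weight on the first is
    at least 2. *)
Lemma norm_segment_add X (x y p : X) (m : R) : `|x| = 1 -> `|y| = 1 ->
  `|p| = 1 ->
  0 < m < 1 -> `|(1 - m) *: x + m *: y + p| = 2 -> `|x + p| = 2.
Proof.
move=> x1 y1 p1 /andP[m0 m1] h.
have le2 (z : X) : `|z| = 1 -> `|z + p| <= 2.
  by move=> z1; apply: le_trans (ler_normD _ _) _; rewrite z1 p1.
apply/eqP; rewrite eq_le le2//=.
have : `|(1 - m) *: x + m *: y + p| <= (1 - m) * `|x + p| + m * `|y + p|.
  have -> : (1 - m) *: x + m *: y + p = (1 - m) *: (x + p) + m *: (y + p).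
    by rewrite !scalerDr addrACA -scalerDl subrK scale1r.
  apply: le_trans (ler_normD _ _) _.
  by rewrite !normrZ !ger0_norm ?subr_ge0 ?(ltW m0) ?(ltW m1).
have := ler_wpM2l (ltW m0) (le2 _ y1).
rewrite h => h1 h2.
have m1' : 0 < 1 - m by rewrite subr_gt0.
rewrite -(ler_pM2l m1'); lra.
Qed.

Definition sphere_isometry X Y (D : X -> Y) :=
  [/\ forall x, `|x| = 1 -> `|D x| = 1,
      forall y, `|y| = 1 -> exists2 x, `|x| = 1 & D x = y &
      forall x y, `|x| = 1 -> `|y| = 1 -> `|D x - D y| = `|x - y|].

Lemma sphere_isometry_inv X Y (D : X -> Y) : sphere_isometry D ->
  exists2 E : Y -> X, sphere_isometry E & forall x, `|x| = 1 -> E (D x) = x.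
Proof.
move=> [D1 Ds Di].
have /choice[E EP] : forall y, exists x, `|y| = 1 -> `|x| = 1 /\ D x = y.
  move=> y; have [/Ds[x x1 xy]|y1] := pselect (`|y| = 1); first by exists x.
  by exists 0.
have ED x : `|x| = 1 -> E (D x) = x.
  move=> x1; have [e1 De] := EP _ (D1 _ x1).
  by apply/eqP; rewrite -subr_eq0 -normr_eq0 -Di// De subrr normr0.
exists E => //; split=> [y /EP[]//|x x1|x y /EP[x1 xE] /EP[y1 yE]].
  by exists (D x); [exact: D1|exact: ED].
by rewrite -Di// xE yE.
Qed.

(* If z lies strictly between x and y and D z' = - D z, then |z - z'| = 2
   forces |x - z'| = 2, that is |D x + D z| = 2; let z tend to y. *)
Lemma sphere_isometry_add2 X Y (D : X -> Y) x y : sphere_isometry D ->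
  `|x| = 1 -> `|y| = 1 -> `|x + y| = 2 -> `|D x + D y| = 2.
Proof.
move=> [D1 Ds Di] x1 y1 xy.
have near (m : R) : 0 < m < 1 -> 2 <= `|D x + D y| + 2 * (1 - m).
  move=> m01; have /andP[m0 m1] := m01.
  set z := (1 - m) *: x + m *: y.
  have z1 : `|z| = 1 by apply: norm_segment => //; rewrite !ltW.
  have [z' z'1 Dz'] : exists2 z', `|z'| = 1 & D z' = - D z.
    by apply: Ds; rewrite normrN D1.
  have Nz' : `|- z'| = 1 by rewrite normrN.
  have zz' : `|z - z'| = 2.
    rewrite -Di// Dz' opprK -mulr2n -scaler_nat normrZ D1//.
    by rewrite ger0_norm ?mulr1.
  have : `|D x + D z| = 2.
    rewrite -[D z]opprK -Dz' Di//.
    exact: (norm_segment_add x1 y1 Nz' m01).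
  have -> : D x + D z = (D x + D y) + (D z - D y) by
    rewrite addrACA subrr addr0.
  move=> h2; rewrite -[leLHS]h2.
  apply: le_trans (ler_normD _ _) _; rewrite lerD2l Di//.
  have -> : z - y = (1 - m) *: (x - y).
    by rewrite /z scalerBr !scalerBl !scale1r opprB addrA addrAC.
  rewrite normrZ ger0_norm ?subr_ge0 ?(ltW m1)// mulrC.
  rewrite ler_wpM2r ?subr_ge0 ?(ltW m1)//.
  by apply: le_trans (ler_normB _ _) _; rewrite x1 y1; lra.
apply/eqP; rewrite eq_le; apply/andP; split.
  by apply: le_trans (ler_normD _ _) _; rewrite !D1//; lra.
rewrite leNgt; apply/negP => lt2.
have n0 := normr_ge0 (D x + D y).
(* This parameter makes [2 * (1 - m)] half of the supposed deficit [2 - |D x + D y|]. *)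
by have := near (1 - (2 - `|D x + D y|) / 4) ltac:(apply/andP; split; lra); lra.
Qed.

(** The infimum [p y] of [|y + l *: c| - l] over [l > 0] and [c] in [C] is sublinear by convexity of
    [C]. A linear [f] below [p] is below the norm, and [p (- c) <= -1] gives [1 <= f c]. *)
Lemma convex_sphere_support Y (C : set Y) : C !=set0 ->
  (forall c, C c -> `|c| = 1) ->
  (forall c d m, C c -> C d -> 0 < m < 1 -> C ((1 - m) *: c + m *: d)) ->
  exists f : {scalar Y}, (forall y, f y <= `|y|) /\ (forall c, C c -> f c = 1).
Proof.
move=> [c0 Cc0] C1 Cc.
pose S y := [set z | exists l c, [/\ 0 < l, C c & z = `|y + l *: c| - l]].
have S0 y : S y !=set0 by exists (`|y + 1 *: c0| - 1), 1, c0.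
have S_lb y : has_lbound (S y).
  exists (- `|y|) => _ [l [c [l0 Cc' ->]]].
  have := ler_normB (y + l *: c) y.
  by rewrite addrAC subrr add0r normrZ C1// mulr1 gtr0_norm//; lra.
pose p y := inf (S y).
have ple y l c : 0 < l -> C c -> p y <= `|y + l *: c| - l.
  by move=> l0 Cc'; apply: ge_inf => //; exists l, c.
have lep y z : (forall l c, 0 < l -> C c -> z <= `|y + l *: c| - l) -> z <= p y.
  by move=> h; apply: lb_le_inf => // _ [l [c [l0 Cc' ->]]]; exact: h.
have sp : sublinear p.
  split=> [x y|k x k0].
    rewrite -lerBlDr; apply/lep => l c l0 Cc1; rewrite lerBlDr -lerBlDl.
    apply/lep => m d m0 Cd; rewrite lerBlDl.
    have lm0 : l + m != 0 by rewrite gt_eqF ?addr_gt0.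
    have mlm : 0 < m / (l + m) < 1.
      by rewrite divr_gt0 ?addr_gt0//= ltr_pdivrMr ?addr_gt0// mul1r ltrDr.
    have := ple (x + y) (l + m) _ (addr_gt0 l0 m0) (Cc _ _ _ Cc1 Cd mlm).
    move=> /le_trans; apply.
    have -> : x + y + (l + m) *: ((1 - m / (l + m)) *: c + (m / (l + m)) *: d) =
        (x + l *: c) + (y + m *: d).
      rewrite scalerDr !scalerA [(l + m) * (1 - _)]mulrBr mulr1.
      by rewrite mulrCA divff// mulr1 addrK addrACA.
    by have := ler_normD (x + l *: c) (y + m *: d); lra.
  rewrite -ler_pdivrMl//; apply/lep => l c l0 Cc1; rewrite ler_pdivrMl//.
  apply: (le_trans (ple _ (k * l) c _ _)) => //; first exact: mulr_gt0.
  by rewrite -scalerA -scalerDr normrZ gtr0_norm// mulrBr.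
have [f fp] := hahn_banach sp.
have fle y : f y <= `|y|.
  apply: (le_trans (fp y)); apply: (le_trans (ple y 1 c0 ltr01 Cc0)).
  by have := ler_normD y (1 *: c0); rewrite scale1r (C1 _ Cc0); lra.
exists f; split => // c Cc1; apply/eqP; rewrite eq_le -{1}(C1 _ Cc1) fle/=.
have := le_trans (fp (- c)) (ple (- c) 1 c ltr01 Cc1).
by rewrite scale1r addNr normr0 linearN/=; lra.
Qed.

End normed_spheres.

(** * Inner product identities and strict convexity *)

Section inner_product.
Context (R : realType) (H : normedModType R) (dot : {dot H for idfun}).
Context (hdot : forall x : H, `|x| ^+ 2 = dot x x).

Lemma dotC (x y : H) : dot x y = dot y x.
Proof. by rewrite hermC expr0 mul1r. Qed.

Lemma normD_sqr (x y : H) :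
  `|x + y| ^+ 2 = `|x| ^+ 2 + 2 * dot x y + `|y| ^+ 2.
Proof. by rewrite !hdot !linearDr/= !linearDl/= (dotC y x); ring. Qed.

Lemma parallelogram (x y : H) :
  `|x + y| ^+ 2 + `|x - y| ^+ 2 = 2 * `|x| ^+ 2 + 2 * `|y| ^+ 2.
Proof. by rewrite !normD_sqr normrN linearNr/=; ring. Qed.

Lemma sqr_norm_le0 (x : H) : `|x| ^+ 2 <= 0 -> x = 0.
Proof. by rewrite exprn_even_le0//= normr_eq0 => /eqP. Qed.

Lemma norm_add2_eq (x y : H) : `|x| <= 1 -> `|y| <= 1 -> `|x + y| = 2 ->
  `|x| = 1 /\ x = y.
Proof.
move=> x1 y1 xy.
have xn1 : `|x| = 1.
  by apply/eqP; rewrite eq_le x1/=; have := ler_normD x y; rewrite xy; lra.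
split => //; apply/eqP; rewrite -subr_eq0; apply/eqP/sqr_norm_le0.
have y2 : `|y| ^+ 2 <= 1 by rewrite expr_le1.
by have := parallelogram x y; rewrite xy xn1; lra.
Qed.

(** The parallelogram law for [y - x] and [y], whose difference is [- x], makes their sum [2 y - x]
    vanish. *)
Lemma half_unique (x y : H) : `|y - x| <= `|x| / 2 -> `|y| <= `|x| / 2 ->
  y = 2^-1 *: x.
Proof.
move=> h1 h2.
have k1 : `|y - x| ^+ 2 <= (`|x| / 2) ^+ 2 by rewrite lerXn2r ?nnegrE ?divr_ge0.
have k2 : `|y| ^+ 2 <= (`|x| / 2) ^+ 2 by rewrite lerXn2r ?nnegrE ?divr_ge0.
have := parallelogram (y - x) y; rewrite [y - x - y]addrAC subrr add0r normrN.
move=> h; have /sqr_norm_le0 : `|y - x + y| ^+ 2 <= 0.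
  have e : (`|x| / 2) ^+ 2 = `|x| ^+ 2 / 4 by field.
  by move: k1 k2; rewrite e; lra.
rewrite addrAC => /eqP; rewrite subr_eq0 => /eqP <-.
by rewrite -mulr2n -(scaler_nat 2 y) scalerA mulVf ?scale1r// pnatr_eq0.
Qed.

(** Obtained from [0 <= (|e + d *: v| - 1) ^+ 2]; this second-order bound replaces the derivative of
    the norm at [e]. *)
Lemma norm_e_add_le (e v : H) d : `|e| = 1 ->
  `|e + d *: v| <= 1 + d * dot v e + d ^+ 2 * `|v| ^+ 2 / 2.
Proof.
move=> e1.
have sq : `|e + d *: v| ^+ 2 = 1 + 2 * (d * dot v e) + d ^+ 2 * `|v| ^+ 2.
  rewrite normD_sqr e1 expr1n dotC linearZl_LR/= normrZ exprMn.
  by rewrite real_normK ?num_real.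
by have := sqr_ge0 (`|e + d *: v| - 1); rewrite sqrrB sq expr1n mulr1; lra.
Qed.

End inner_product.

(** * Continuous functions on a compact Hausdorff space *)

Section continuous_functions.
Context (R : realType) (K : topologicalType) (cK : compact [set: K])
  (hK : hausdorff_space K) (H : completeNormedModType R).
Local Notation C := (contfun cK H).
Implicit Types (f g x y : C) (t s k : K).

Lemma bump (t : K) (V : set K) : nbhs t V ->
  exists h : K -> R, [/\ continuous h, forall k, 0 <= h k <= 1, h t = 1 &
    forall k, ~ V k -> h k = 0].
Proof.
move=> /nbhs_interior tV.
have [|h [hc h01 h0 h1]] := (@uniform_separatorP K R (~` V^°) [set t]).1.
  apply: normal_uniform_separator.
  - exact: compact_normal.
  - exact/open_closedC/open_interior.
  - exact/accessible_closed_set1/hausdorff_accessible.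
  - by apply/disjoints_subset => k nVk kt; apply: nVk; rewrite kt;
    exact: nbhs_singleton.
exists h; split => // [k||k Vk].
- by have := h01 (h k) (ex_intro2 _ _ k I erefl); rewrite /= in_itv.
- by apply: h1; exists t.
- by apply: h0; exists k => //; apply: contra_not Vk; exact: interior_subset.
Qed.

Lemma contfunDE x y k : contfun_fun (x + y) k = x k + y k.
Proof. by []. Qed.

Lemma contfunBE x y k : contfun_fun (x - y) k = x k - y k.
Proof. by []. Qed.

Lemma contfunNE x k : contfun_fun (- x) k = - x k.
Proof. by []. Qed.

Lemma contfunZE (c : R) x k : contfun_fun (c *: x) k = c *: x k.
Proof. by []. Qed.

Lemma contfun_combination x (e : H) (c d : K -> R) : continuous c ->
  continuous d ->
  exists y : C, forall k, y k = c k *: x k + d k *: e.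
Proof.
move=> cc dc.
have yc : continuous (fun k => c k *: x k + d k *: e).
  move=> k; apply: cvgD; apply: cvgZ;
    [exact: cc|exact: contfun_continuous|exact: dc|exact: cvg_cst].
by exists (contfun_pack cK yc).
Qed.

(** Compactness makes the supremum a maximum; an empty [K] is excluded because its functions have
    norm 0. *)
Lemma contfun_normP x : `|x| = 1 <->
  (forall k, `|x k| <= 1) /\ exists k, `|x k| = 1.
Proof.
split=> [x1|[le1 [k xk]]].
  split=> [k|]; first by rewrite -x1; exact: contfun_norm_ub.
  have K0 : [set: K] !=set0.
    apply/set0P/eqP => K0; move: x1; rewrite contfun_normE K0 image_set0 sup0.
    by move/esym/eqP; rewrite oner_eq0.
  have [|k _ kmax] := @compact_EVT_max K R (fun k => `|x k|) _ K0 cK.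
    apply: continuous_subspaceT => k; apply: cvg_norm;
      exact: contfun_continuous.
  exists k; apply/eqP; rewrite eq_le -{1}x1 contfun_norm_ub/= -[leLHS]x1.
  by apply: contfun_norm_le => // s; apply: kmax; rewrite inE.
apply/eqP; rewrite eq_le -{2}xk contfun_norm_ub andbT.
exact: contfun_norm_le.
Qed.

Lemma norm_le_contfun x (M : R) : 0 <= M -> (forall k, `|x k| <= M) ->
  `|x| <= M.
Proof. exact: contfun_norm_le. Qed.

Lemma le_norm_contfun x k : `|x k| <= `|x|.
Proof. exact: contfun_norm_ub. Qed.

Lemma contfun_cst (e : H) : exists x : C, forall k, x k = e.
Proof.
have ec : continuous (fun _ : K => e) by move=> k; exact: cvg_cst.
by exists (contfun_pack cK ec).
Qed.

Lemma nbhs_near x t (e : R) : 0 < e -> nbhs t [set k | `|x k - x t| < e].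
Proof.
move=> e0; have /cvgrPdist_lt/(_ _ e0) := @contfun_continuous _ _ cK _ x t.
by apply: filterS => k; rewrite distrC.
Qed.

Lemma nbhs_neq s t : s != t -> nbhs t [set k | k <> s].
Proof.
move=> st; apply: open_nbhs_nbhs; split; last by apply/eqP; rewrite eq_sym.
exact/closed_openC/accessible_closed_set1/hausdorff_accessible.
Qed.

(* x' is x multiplied by 1 - e away from t. *)
Lemma exists_peaked x f t (e : R) : `|x| = 1 -> `|x t| = 1 -> 0 < e < 1 ->
  exists x' : C, [/\ `|x'| = 1, x' t = x t, `|x' - x| <= e &
    forall k, `|x' k| = 1 -> `|x' k - x t| <= e /\ `|f k - f t| <= e].
Proof.
move=> x1 xt1 /andP[e0 e1].
have [xle _] := (contfun_normP x).1 x1.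
have [h [hc h01 ht hV]] := bump (filterI (nbhs_near x t e0) (nbhs_near f t e0)).
(* [c k = 1] only where [h k = 1], which confines the points where [x'] has norm one to the chosen
   neighbourhood of [t]. *)
pose c k := 1 - e * (1 - h k).
have cc : continuous c.
  move=> k; apply: cvgB; first exact: cvg_cst.
  apply: cvgM; first exact: cvg_cst.
  by apply: cvgB; [exact: cvg_cst|exact: hc].
have [x' x'E'] := @contfun_combination x 0 c (fun=> 0) cc ltac:(by move=> ?;
  exact: cvg_cst).
have x'E k : x' k = c k *: x k by rewrite x'E' scaler0 addr0.
have c01 k : 0 <= c k <= 1.
  by have := h01 k; rewrite /c => /andP[]; nra.
have x'n k : `|x' k| = c k * `|x k|.
  by rewrite x'E normrZ ger0_norm//; case/andP: (c01 k).
have x't : x' t = x t by rewrite x'E /c ht subrr mulr0 subr0 scale1r.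
exists x'; split => //.
- apply/contfun_normP; split; last by exists t; rewrite x't.
  by move=> k; rewrite x'n; have := c01 k; have := xle k;
    have := normr_ge0 (x k); nra.
- apply: norm_le_contfun => [|k]; first exact: ltW.
  rewrite contfunBE x'E -[X in _ - X]scale1r -scalerBl normrZ distrC ger0_norm
    ?subr_ge0; last by case/andP: (c01 k).
  have -> : 1 - c k = e * (1 - h k) by rewrite /c; ring.
  have /andP[h0 h1] := h01 k.
  by rewrite -mulrA ler_piMr ?(ltW e0)// mulr_ile1 ?subr_ge0// gerBl.
- move=> k; rewrite x'n => ck.
  have hk : h k = 1.
    have c1 : 1 <= c k by rewrite -ck ler_piMr//; case/andP: (c01 k).
    have /andP[_ h1] := h01 k.
    apply/eqP; rewrite eq_le h1/= -subr_le0 -(pmulr_rle0 _ e0).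
    by move: c1; rewrite /c; lra.
  have [Vk1 Vk2] : `|x k - x t| < e /\ `|f k - f t| < e.
    by apply: contrapT => /hV; rewrite hk => /eqP; rewrite oner_eq0.
  by rewrite x'E /c hk subrr mulr0 subr0 scale1r !ltW.
Qed.

End continuous_functions.

(** * Images of the maximal faces *)

Section sphere_isometries_of_contfun.
Context (R : realType) (K : topologicalType) (cK : compact [set: K])
  (hK : hausdorff_space K) (H : completeNormedModType R).
Context (dot : {dot H for idfun}) (hdot : forall x : H, `|x| ^+ 2 = dot x x).
Local Notation C := (contfun cK H).
Context (Y : completeNormedModType R) (D : C -> Y) (hD : sphere_isometry D).
Implicit Types (x y z : C) (s t k : K).

Let D1 x : `|x| = 1 -> `|D x| = 1. Proof. by case: hD => + _ _; apply. Qed.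

Let Ds (w : Y) : `|w| = 1 -> exists2 x : C, `|x| = 1 & D x = w.
Proof. by case: hD => _ + _; apply. Qed.

Let Di x y : `|x| = 1 -> `|y| = 1 -> `|D x - D y| = `|x - y|.
Proof. by case: hD => _ _; apply. Qed.

Lemma face_add2 x y t : `|x| = 1 -> `|y| = 1 -> `|x t| = 1 -> x t = y t ->
  `|x + y| = 2.
Proof.
move=> x1 y1 xt1 xyt; apply/eqP; rewrite eq_le; apply/andP; split.
  by apply: le_trans (ler_normD _ _) _; rewrite x1 y1.
apply: le_trans (le_norm_contfun (x + y) t).
by rewrite contfunDE -xyt -mulr2n normrMn xt1.
Qed.

(** Half the sum has norm one and attains it at some [k]; strict convexity of [H] makes the two
    values coincide there. *)
Lemma add2_common_face x y : `|x| = 1 -> `|y| = 1 -> `|x + y| = 2 ->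
  exists k, `|x k| = 1 /\ x k = y k.
Proof.
move=> x1 y1 xy.
have /contfun_normP[_ [k]] : `|2^-1 *: (x + y)| = 1.
  by rewrite normrZ xy ger0_norm ?invr_ge0// mulVf.
rewrite contfunZE normrZ ger0_norm ?invr_ge0// contfunDE => hk.
exists k; apply: (norm_add2_eq hdot).
- by rewrite -x1 le_norm_contfun.
- by rewrite -y1 le_norm_contfun.
- by lra.
Qed.

Lemma isometry_add2_inv x y : `|x| = 1 -> `|y| = 1 -> `|D x + D y| = 2 ->
  `|x + y| = 2.
Proof.
move=> x1 y1 h; have [E hE ED] := sphere_isometry_inv hD.
by rewrite -(ED x)// -(ED y)//; apply: (sphere_isometry_add2 hE); rewrite ?D1.
Qed.

(* The preimage [z'] of a point between [D x'] and [D y], with [x'] peaked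
   near t, shares a face with [x'], hence is close to [x t] somewhere near t. *)
Lemma face_segment x y t (m : R) : `|x| = 1 -> `|y| = 1 -> `|x t| = 1 ->
    x t = y t -> 0 < m < 1 ->
  exists z : C, [/\ `|z| = 1, z t = x t & D z = (1 - m) *: D x + m *: D y].
Proof.
move=> x1 y1 xt1 xyt m01.
have m01' : 0 <= m <= 1 by case/andP: m01 => /ltW -> /ltW ->.
have seg x' : `|x'| = 1 -> x' t = x t ->
    `|(1 - m) *: D x' + m *: D y| = 1.
  move=> x'1 x't; apply: norm_segment; rewrite ?D1//.
  by apply: (sphere_isometry_add2 hD) => //; apply: (@face_add2 _ _ t);
    rewrite ?x't.
have [z z1 Dz] := Ds (seg x x1 erefl).
exists z; split => //; apply/eqP; rewrite -subr_eq0 -normr_le0.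
rewrite leNgt; apply/negP => zx0.
(* A quarter of the supposed error: [z t] is joined to [x t] through [z k] and [z' k] by three steps
   of length at most [e]. The cap 1/2 ensures [e < 1]. *)
pose e := Num.min (1 / 2) (`|z t - x t| / 4).
have e0 : 0 < e by rewrite lt_min; apply/andP; split; lra.
have e1 : e < 1 by rewrite gt_min; apply/orP; left; lra.
have [x' [x'1 x't x'x peak]] :=
  exists_peaked hK z x1 xt1 (introT andP (conj e0 e1)).
have [z' z'1 Dz'] := Ds (seg x' x'1 x't).
have /(add2_common_face z'1 x'1)[k [z'k zxk]] : `|z' + x'| = 2.
  apply: isometry_add2_inv => //;
    rewrite Dz' -[X in _ + X]scale1r addrAC -scalerDl.
  have xy2 : `|D x' + D y| = 2.
    by apply: (sphere_isometry_add2 hD) => //; apply: (@face_add2 _ _ t);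
      rewrite ?x't.
  (* [D z' + D x'] is twice the point with parameter [m / 2] between [D x'] and [D y]. *)
  have m2 : 0 <= m / 2 <= 1 by apply/andP; case/andP: m01 => ? ?; split; lra.
  have := norm_segment (D1 x'1) (D1 y1) xy2 m2.
  have -> : (1 - m + 1) *: D x' + m *: D y =
      2 *: ((1 - m / 2) *: D x' + (m / 2) *: D y).
    by rewrite scalerDr !scalerA; congr (_ *: _ + _ *: _); field.
  by rewrite normrZ => ->; rewrite mulr1 ger0_norm.
have [xk zk] : `|x' k - x t| <= e /\ `|z k - z t| <= e by apply: peak;
  rewrite -zxk.
have zz' : `|z' - z| <= e.
  rewrite -Di// Dz Dz' opprD addrACA subrr addr0 -scalerBr normrZ Di//.
  apply: le_trans x'x; rewrite ler_piMl//.
  by case/andP: m01' => ? ?; rewrite ger0_norm ?subr_ge0// gerBl.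
have e4 : e <= `|z t - x t| / 4 by rewrite ge_min lexx orbT.
have := ler_normD (z t - z k) (z k - x t); rewrite subrKA.
have := ler_normD (z k - z' k) (z' k - x t); rewrite subrKA.
have : `|z k - z' k| <= e.
  by rewrite distrC -contfunBE (le_trans (le_norm_contfun _ _)).
by rewrite zxk [`|z t - z k|]distrC; lra.
Qed.

(** Replace [x] by a peaked approximation [y], and let [D y' = - D y]. Then [|y - y'| = 2], so [y]
    and [- y'] agree at a point [k] where [y k] is close to [x t] and [x' k] to [x' t]; moreover
    [y'] is as close to [x'] as [y] is to [x]. *)
Lemma face_opp x x' t : `|x| = 1 -> `|x'| = 1 -> `|x t| = 1 ->
  D x' = - D x -> x' t = - x t.
Proof.
move=> x1 x'1 xt1 Dx'.
apply/eqP; rewrite -subr_eq0 opprK -normr_le0 leNgt; apply/negP => x0.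
pose e := Num.min (1 / 2) (`|x' t + x t| / 4).
have e0 : 0 < e by rewrite lt_min; apply/andP; split; lra.
have e1 : e < 1 by rewrite gt_min; apply/orP; left; lra.
have [y [y1 yt yx peak]] :=
  exists_peaked hK x' x1 xt1 (introT andP (conj e0 e1)).
have [y' y'1 Dy'] : exists2 y' : C, `|y'| = 1 & D y' = - D y.
  by apply: Ds; rewrite normrN D1.
have Ny'1 : `|- y'| = 1 by rewrite normrN.
have /(add2_common_face y1 Ny'1)[k [yk]] : `|y - y'| = 2.
  rewrite -Di// Dy' opprK -mulr2n normrMn D1//.
rewrite contfunNE => yy'.
have [xk x'k] := peak _ yk.
have zz' : `|y' - x'| <= e.
  by rewrite -(Di y'1 x'1) Dy' Dx' opprK addrC (Di x1 y1) distrC.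
have e4 : e <= `|x' t + x t| / 4 by rewrite ge_min lexx orbT.
have := ler_normD (x' t - x' k) (x' k + x t); rewrite addrA subrK.
have := ler_normD (x' k - y' k) (y' k + x t); rewrite addrA subrK.
have : `|x' k - y' k| <= e.
  by rewrite distrC -contfunBE (le_trans (le_norm_contfun _ _)).
have -> : `|y' k + x t| = `|y k - x t| by rewrite yy' -opprD normrN.
by rewrite [`|x' t - x' k|]distrC; lra.
Qed.

(** The second clause is (i); for a unit vector [e] it reduces to [f (D x) = 1] when [x t = e]. *)
Definition supports (f : {scalar Y}) (t : K) (e : H) :=
  (forall w : Y, f w <= `|w|) /\
  (forall x, `|x| = 1 -> 1 - `|e - x t| <= f (D x) <= `|e + x t| - 1).

(** [y] is [(1 - h) *: x + h *: e] for a bump [h] at [t] that vanishes where [x] is not within [d]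
    of [x t]. *)
Lemma near_face x t (e : H) (d : R) : `|x| = 1 -> `|e| = 1 -> 0 < d ->
  exists y : C, [/\ `|y| = 1, y t = e & `|y - x| <= `|e - x t| + d].
Proof.
move=> x1 e1 d0.
have [h [hc h01 ht hV]] := bump R cK hK (nbhs_near x t d0).
have hc' : continuous (fun k => 1 - h k).
  by move=> k; apply: cvgB; [exact: cvg_cst|exact: hc].
have [y yE] := contfun_combination x e hc' hc.
have yt : y t = e by rewrite yE ht subrr scale0r add0r scale1r.
exists y; split => //.
  apply/contfun_normP; split; last by exists t; rewrite yt.
  move=> k; rewrite yE; have /andP[h0 h1] := h01 k.
  apply: le_trans (ler_normD _ _) _; rewrite !normrZ e1 mulr1.
  rewrite !ger0_norm ?subr_ge0//.
  have := le_norm_contfun x k; rewrite x1 => xk.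
  have : (1 - h k) * `|x k| <= (1 - h k) * 1 by rewrite ler_wpM2l ?subr_ge0.
  lra.
apply: norm_le_contfun => [|k]; first by rewrite addr_ge0 ?(ltW d0).
have -> : contfun_fun (y - x) k = h k *: (e - x k).
  by rewrite contfunBE yE scalerBl scale1r scalerBr addrAC [_ - x k]addrAC
    subrr add0r addrC.
have /andP[h0 h1] := h01 k; rewrite normrZ ger0_norm//.
have [Vk|/hV ->] := pselect (`|x k - x t| < d); last first.
  by rewrite mul0r addr_ge0 ?(ltW d0).
rewrite -[leRHS]mul1r ler_pM//.
have := ler_normD (e - x t) (x t - x k); rewrite subrKA [`|x t - x k|]distrC.
by lra.
Qed.

Lemma exists_support t (e : H) : `|e| = 1 -> exists f, supports f t e.
Proof.
move=> e1.
pose F := [set D x | x in [set x : C | `|x| = 1 /\ x t = e]].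
have [|||f [fle f1]] := @convex_sphere_support R Y F.
- have [x xE] := contfun_cst cK e.
  exists (D x), x => //; split; last exact: xE.
  by apply/contfun_normP; split => [k|]; [|exists t]; rewrite xE e1.
- by move=> _ [x [x1 _] <-]; exact: D1.
- move=> _ _ m [x [x1 xt] <-] [y [y1 yt] <-] m01.
  have [|||||z [z1 zt Dz]] := @face_segment x y t m; rewrite ?xt ?yt//.
  by exists z => //; rewrite /= zt xt.
exists f; split => // x x1; apply/andP; split; apply/ler_addgt0Pl => d d0.
  have [y [y1 yt yx]] := near_face t x1 e1 d0.
  have : f (D y) - f (D x) <= `|y - x| by rewrite -linearB/= -Di.
  by rewrite f1; [lra|exists y].
(* For the upper bound [y t = - e]: the function with image [- D y] lies in the face of [e], so that
   [f (D y) = -1]. *)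
have [y [y1 yt yx]] := near_face t x1 (etrans (normrN e) e1) d0.
have [y' y'1 Dy'] : exists2 y' : C, `|y'| = 1 & D y' = - D y.
  by apply: Ds; rewrite normrN D1.
have y't : y' t = e by rewrite (face_opp y1 y'1 _ Dy') yt ?opprK ?normrN.
have : f (D y) = -1.
  have : f (D y') = 1 by rewrite f1//; exists y'.
  by rewrite Dy' linearN/=; lra.
have : f (D x) - f (D y) <= `|y - x| by rewrite -linearB/= distrC -Di.
by move: yx; rewrite -opprD normrN; lra.
Qed.

End sphere_isometries_of_contfun.

(** * Support functionals are evaluations *)

Section evaluation_functionals.
Context (R : realType) (K : topologicalType) (cK : compact [set: K])
  (hK : hausdorff_space K) (H : completeNormedModType R).
Context (dot : {dot H for idfun}) (hdot : forall x : H, `|x| ^+ 2 = dot x x).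
Local Notation C := (contfun cK H).
Context (Y : completeNormedModType R) (D : C -> Y) (hD : sphere_isometry D).
Context (t : K) (e : H) (e1 : `|e| = 1) (f : {scalar Y})
  (fs : supports D f t e).
Implicit Types (x y z : C) (s k : K).

Let D1 x : `|x| = 1 -> `|D x| = 1. Proof. by case: hD => + _ _; apply. Qed.

Let Di x y : `|x| = 1 -> `|y| = 1 -> `|D x - D y| = `|x - y|.
Proof. by case: hD => _ _; apply. Qed.

Lemma support_lip x y : `|x| = 1 -> `|y| = 1 -> f (D x) - f (D y) <= `|x - y|.
Proof. by move=> x1 y1; rewrite -linearB/= -Di//; exact: fs.1. Qed.

Lemma support_eq0 x : `|x| = 1 -> x t = 0 -> f (D x) = 0.
Proof.
move=> x1 xt; have := fs.2 _ x1; rewrite xt subr0 addr0 e1 subrr.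
by rewrite -eq_le => /eqP.
Qed.

(* The midpoint of D x and D y is the image of some z in the face of x
   at s; at t the conditions |z - x| <= |x t| / 2 and |z - y| <= |x t| / 2
   leave only the value x t / 2. *)
Lemma support_half x s : s != t -> `|x| = 1 -> `|x s| = 1 ->
  exists z : C, [/\ `|z| = 1, `|z s| = 1, z t = 2^-1 *: x t &
    f (D z) = 2^-1 * f (D x)].
Proof.
move=> st x1 xs1.
have [xt0|xt0] := eqVneq (x t) 0.
  by exists x; rewrite xt0 scaler0 support_eq0// mulr0.
set r := `|x t|; have r0 : 0 < r by rewrite normr_gt0.
(* [h] vanishes at [s], so that [y] keeps the value of [x] there and shares a face with it, while
   [h t = 1] makes [y t = 0]. *)
have [h [hc h01 ht hV]] := bump R cK hK (nbhs_neq hK st).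
(* This factor is 1 where |x k| = r, and 0 <= b m <= 2, b m * m <= r. *)
pose b (m : R) := 2 * r ^+ 2 / (r ^+ 2 + m ^+ 2).
have den (m : R) : 0 < r ^+ 2 + m ^+ 2 by rewrite ltr_wpDr ?sqr_ge0 ?exprn_gt0.
have b02 (m : R) : 0 <= b m <= 2.
  rewrite /b ler_pdivrMr// ler_pM2l// lerDl sqr_ge0 andbT.
  by rewrite divr_ge0 ?(ltW (den m))// mulr_ge0 ?sqr_ge0.
have bm (m : R) : 0 <= m -> b m * m <= r.
  move=> m0; rewrite /b mulrAC ler_pdivrMr//.
  have := mulr_ge0 (ltW r0) (sqr_ge0 (r - m)).
  by rewrite sqrrB !mulrDr mulrN; lra.
pose c k := 1 - h k * b `|x k|.
have cc : continuous c.
  move=> k; apply: cvgB; first exact: cvg_cst.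
  apply: cvgM; first exact: hc.
  apply: cvgM; first exact: cvg_cst.
  apply: cvgV; first by rewrite gt_eqF.
  apply: cvgD; first exact: cvg_cst.
  apply: (@continuous_comp _ _ _ (fun k => `|x k|) (fun m : R => m ^+ 2)).
    by apply: cvg_norm; exact: contfun_continuous.
  exact: exprn_continuous.
have [y yE'] :=
  @contfun_combination _ _ cK _ x 0 c (fun=> 0) cc ltac:(by move=> ?;
    exact: cvg_cst).
have yE k : y k = c k *: x k by rewrite yE' scaler0 addr0.
have cs : c s = 1.
  by rewrite /c (hV s) ?mul0r ?subr0// => /(_ erefl).
have xle k : `|x k| <= 1 by rewrite -x1 le_norm_contfun.
have c1 k : `|c k| <= 1.
  have /andP[h0 h1] := h01 k; have /andP[b0 b2] := b02 `|x k|.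
  by rewrite ler_norml /c; apply/andP; split; nra.
have y1 : `|y| = 1.
  apply/contfun_normP; split; last by exists s; rewrite yE cs scale1r.
  by move=> k; rewrite yE normrZ mulr_ile1.
have yt : y t = 0.
  rewrite yE /c ht mul1r /b -/r.
  have -> : 2 * r ^+ 2 / (r ^+ 2 + r ^+ 2) = 1 by field; rewrite gt_eqF// den.
  by rewrite subrr scale0r.
have yx : `|y - x| <= r.
  apply: norm_le_contfun => [|k]; first exact: ltW.
  rewrite contfunBE yE -[X in _ - X]scale1r -scalerBl normrZ /c addrAC subrr
    add0r.
  have /andP[h0 h1] := h01 k; have /andP[b0 b2] := b02 `|x k|.
  rewrite normrN ger0_norm ?(mulr_ge0 h0 b0)//.
  apply: le_trans (bm _ (normr_ge0 (x k))).
  by rewrite -mulrA ler_piMl// (mulr_ge0 b0).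
have ys : x s = y s by rewrite yE cs scale1r.
have h2 : 0 < (2^-1 : R) < 1 by rewrite invr_gt0 ltr0n invf_lt1// ltr1n.
have [z [z1 zs Dz]] := face_segment hK hdot hD x1 y1 xs1 ys h2.
exists z; split => //; first by rewrite zs.
  apply: (half_unique hdot).
    apply: le_trans (_ : `|z - x| <= _);
      first exact: (le_norm_contfun (z - x) t).
    have -> : `|z - x| = `|D z - D x| by rewrite Di.
    have -> : D z - D x = 2^-1 *: (D y - D x).
      by rewrite Dz scalerBl scale1r scalerBr addrC addrA addKr addrC.
    by rewrite normrZ Di// ger0_norm ?invr_ge0// mulrC ler_wpM2r ?invr_ge0.
  rewrite -[z t]subr0 -yt.
  apply: le_trans (_ : `|z - y| <= _); first exact: (le_norm_contfun (z - y) t).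
  have -> : `|z - y| = `|D z - D y| by rewrite Di.
  have -> : D z - D y = - (2^-1 *: (D y - D x)).
    rewrite Dz; have -> : 1 - 2^-1 = 2^-1 :> R by field.
    rewrite scalerBr opprB -addrA; congr (_ + _).
    by rewrite -[X in _ - X]scale1r -scalerBl -scaleNr; congr (_ *: _); field.
  by rewrite normrN normrZ Di// ger0_norm ?invr_ge0// mulrC ler_wpM2r ?invr_ge0.
rewrite Dz linearD/= !linearZ/= (support_eq0 y1 yt) mulr0 addr0.
by congr (_ * _); field.
Qed.

Lemma support_pow2 x s n : s != t -> `|x| = 1 -> `|x s| = 1 ->
  exists z : C, [/\ `|z| = 1, `|z s| = 1, z t = 2^-1 ^+ n *: x t &
    f (D z) = 2^-1 ^+ n * f (D x)].
Proof.
move=> st x1 xs1; elim: n => [|n [z [z1 zs zt fz]]].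
  by exists x; rewrite expr0 scale1r mul1r.
have [y [y1 ys yt fy]] := support_half st z1 zs.
by exists y; rewrite yt fy zt fz exprS scalerA mulrA.
Qed.

(** With [d = 2^-n], (i) for the function of [support_pow2] compares [d * f (D x)] with
    [d * dot (x t) e] up to [d ^+ 2 / 2]; divide by [d] and let it tend to 0. *)
Lemma support_eval_off x s : s != t -> `|x| = 1 -> `|x s| = 1 ->
  f (D x) = dot (x t) e.
Proof.
move=> st x1 xs1.
have small (p : R) : 0 < p -> exists n, 2^-1 ^+ n < p.
  move=> p0; have [n _ /(_ n (leqnn n))] :=
    near_infty_natSinv_expn_lt (PosNum p0).
  by exists n; rewrite exprVn -[_^-1]mul1r.
have xt1 : `|x t| ^+ 2 <= 1 by rewrite expr_le1// -x1 le_norm_contfun.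
apply/eqP; rewrite eq_le; apply/andP; split; apply/ler_addgt0Pl => p p0.
  have [n np] := small p p0; set d := _ ^+ n in np.
  have d0 : 0 < d by rewrite exprn_gt0 ?invr_gt0.
  have [z [z1 _ zt fz]] := support_pow2 n st x1 xs1.
  have /andP[_] := fs.2 _ z1; rewrite zt fz -/d => h.
  rewrite -(ler_pM2l d0); have := norm_e_add_le hdot (x t) d e1.
  have : d ^+ 2 * `|x t| ^+ 2 <= d * p * 1.
    by apply: ler_pM; rewrite ?sqr_ge0// expr2 ler_pM2l// ltW.
  have := mulr_gt0 d0 p0; nra.
have [n np] := small p p0; set d := _ ^+ n in np.
have d0 : 0 < d by rewrite exprn_gt0 ?invr_gt0.
have [z [z1 _ zt fz]] := support_pow2 n st x1 xs1.
have /andP[+ _] := fs.2 _ z1; rewrite zt fz -/d => h.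
rewrite -(ler_pM2l d0); have := norm_e_add_le hdot (x t) (- d) e1.
rewrite scaleNr sqrrN.
have : d ^+ 2 * `|x t| ^+ 2 <= d * p * 1.
  by apply: ler_pM; rewrite ?sqr_ge0// expr2 ler_pM2l// ltW.
have := mulr_gt0 d0 p0; nra.
Qed.

Lemma support_eval_limit_point x : `|x| = 1 -> `|x t| = 1 ->
  ~ nbhs t [set t] -> f (D x) = dot (x t) e.
Proof.
move=> x1 xt1 tlim.
suff close (p : R) : 0 < p -> exists y : C, [/\ `|y| = 1,
  `|y - x| <= p & f (D y) = dot (x t) e].
  apply/eqP; rewrite eq_le; apply/andP; split; apply/ler_addgt0Pl => p p0;
    have [y [y1 yx <-]] := close p p0.
    by have := support_lip x1 y1; rewrite distrC; lra.
  by have := support_lip y1 x1; lra.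
move=> p0.
have xp := nbhs_near x t p0.
have [s [sx st]] : exists s, `|x s - x t| < p /\ s != t.
  apply: contrapT => noS; apply: tlim; apply: filterS xp => s sx /=.
  by apply: contrapT => /eqP st; apply: noS; exists s.
have xps : nbhs s [set k | `|x k - x t| < p].
  have : nbhs s [set k | `|x k - x s| < p - `|x s - x t|] by apply: nbhs_near;
    rewrite subr_gt0.
  by apply: filterS => k /=; have := ler_normD (x k - x s) (x s - x t);
    rewrite subrKA; lra.
have ts : t != s by rewrite eq_sym.
(* The bump is centred at [s] and vanishes at [t]: [y] takes the unit vector [x t] as value at both
   points, and [support_eval_off] applies to it. *)
have [h [hc h01 hs hV]] := bump R cK hK (filterI xps (nbhs_neq hK ts)).
have hc' : continuous (fun k => 1 - h k).
  by move=> k; apply: cvgB; [exact: cvg_cst|exact: hc].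
have [y yE] := contfun_combination x (x t) hc' hc.
have ys : y s = x t by rewrite yE hs subrr scale0r add0r scale1r.
have yt : y t = x t.
  by rewrite yE (hV t) ?subr0 ?scale1r ?scale0r ?addr0// => -[_ /(_ erefl)].
have y1 : `|y| = 1.
  apply/contfun_normP; split; last by exists s; rewrite ys.
  move=> k; rewrite yE; have /andP[h0 h1] := h01 k.
  apply: le_trans (ler_normD _ _) _; rewrite !normrZ xt1 mulr1.
  rewrite !ger0_norm ?subr_ge0//.
  have := le_norm_contfun x k; rewrite x1 => xk.
  have : (1 - h k) * `|x k| <= (1 - h k) * 1 by rewrite ler_wpM2l ?subr_ge0.
  lra.
exists y; split => //; last by rewrite (support_eval_off st y1) ?yt ?ys.
apply: norm_le_contfun => [|k]; first exact: ltW.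
have -> : contfun_fun (y - x) k = h k *: (x t - x k).
  by rewrite contfunBE yE scalerBl scale1r scalerBr addrAC [_ - x k]addrAC
    subrr add0r addrC.
have /andP[h0 h1] := h01 k; rewrite normrZ ger0_norm//.
have [[Vk _]|/hV ->] := pselect (`|x k - x t| < p /\ k <> t); last first.
  by rewrite mul0r ltW.
by rewrite -[leRHS]mul1r ler_pM// distrC ltW.
Qed.

(* Off t, x is moved in the constant direction x t until it reaches norm one
   there; by strict convexity x is then the only metric midpoint available. *)
Lemma support_eval_isolated x s : `|x| = 1 -> `|x t| = 1 ->
  nbhs t [set t] -> s != t -> f (D x) = dot (x t) e.
Proof.
move=> x1 xt1 tiso st.
have [h [hc h01 ht hV]] := bump R cK hK tiso.
have hE k : k != t -> h k = 0 by move=> kt; apply: hV => /= kt';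
  rewrite kt' eqxx in kt.
have hc' : continuous (fun k => 1 - h k).
  by move=> k; apply: cvgB; [exact: cvg_cst|exact: hc].
have xle k : `|x k| <= 1 by rewrite -x1 le_norm_contfun.
have push (v : H) : `|v| = 1 -> exists l (y : C), [/\ 0 <= l, `|y| = 1,
    y t = x t, forall k, k != t -> y k = x k + l *: v & f (D y) = dot (x t) e].
  move=> v1.
  have c0 : continuous (fun _ : K => 0 : R) by move=> ?; exact: cvg_cst.
  have [u uE'] := contfun_combination 0 v c0 hc'.
  have [w wE'] := contfun_combination x 0 hc' c0.
  have uE k : u k = (1 - h k) *: v by rewrite uE' scale0r add0r.
  have wE k : w k = (1 - h k) *: x k by rewrite wE' scaler0 addr0.
  have gc : {within `[0, 2], continuous (fun l : R => `|w + l *: u|)}.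
    apply: continuous_subspaceT => l; apply: cvg_norm; apply: cvgD.
      exact: cvg_cst.
    by apply: cvgZ; [exact: cvg_id|exact: cvg_cst].
  (* Off [t] the function is [x + l *: v], and at [t] it is 0. Its norm is at most 1 for [l = 0] and
     at least [2 - |x s| >= 1] for [l = 2]. *)
  have [|l] := @IVT R _ 0 2 1 ltac:(lra) gc.
    have g0 : `|w + 0 *: u| <= 1.
      rewrite scale0r addr0; apply: norm_le_contfun => // k.
      have /andP[h0 h1] := h01 k.
      by rewrite wE normrZ mulr_ile1 ?ger0_norm ?subr_ge0// gerBl.
    have g2 : 1 <= `|w + 2 *: u|.
      apply: le_trans (le_norm_contfun _ s).
      rewrite contfunDE contfunZE wE uE (hE s st) subr0 !scale1r.
      have := ler_normD (x s + 2 *: v) (- x s);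
        rewrite normrN addrAC subrr add0r.
      by rewrite normrZ v1 mulr1 ger0_norm//; have := xle s; lra.
    by rewrite ge_min g0 le_max g2 orbT.
  rewrite in_itv/= => /andP[l0 l2] wu1.
  have [y yE] : exists y : C, forall k, y k = x k + (l * (1 - h k)) *: v.
    have lc : continuous (fun k => l * (1 - h k)).
      by move=> k; apply: cvgM; [exact: cvg_cst|exact: hc'].
    have oc : continuous (fun _ : K => 1 : R) by move=> ?; exact: cvg_cst.
    have [y yE] := contfun_combination x v oc lc.
    by exists y => k; rewrite yE scale1r.
  have yt : y t = x t by rewrite yE ht subrr mulr0 scale0r addr0.
  have yE' k : k != t -> y k = x k + l *: v.
    by move=> kt; rewrite yE hE// subr0 mulr1.
  have wuE k : k != t -> contfun_fun (w + l *: u) k = y k.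
    by move=> kt; rewrite contfunDE contfunZE wE uE hE// subr0 !scale1r yE'.
  have wut : contfun_fun (w + l *: u) t = 0.
    by rewrite contfunDE contfunZE wE uE ht subrr !scale0r scaler0 addr0.
  have [wule [k wuk]] := (contfun_normP _).1 wu1.
  have kt : k != t.
    by apply: contraPneq wuk => ->; rewrite wut normr0 => /esym/eqP;
      rewrite oner_eq0.
  have yk : `|y k| = 1 by rewrite -wuE.
  have y1 : `|y| = 1.
    apply/contfun_normP; split; last by exists k.
    move=> q; have [->|qt] := eqVneq q t; first by rewrite yt xt1.
    by rewrite -wuE.
  by exists l, y; split => //; rewrite (support_eval_off kt y1 yk) yt.
have [l [a [l0 a1 at_ aE fa]]] := push (x t) xt1.
have [m [b [m0 b1 bt bE fb]]] := push (- x t) (etrans (normrN _) xt1).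
have eqx (y : C) q v : y t = x t -> (forall k, k != t -> y k = x k + q *: v) ->
    q = 0 -> y = x.
  move=> yt yE q0; apply: contfun_ext => k.
  by have [->//|kt] := eqVneq k t; rewrite yE// q0 scale0r addr0.
have [l00|ln0] := eqVneq l 0; first by rewrite -fa (eqx a l (x t)).
have [m00|mn0] := eqVneq m 0; first by rewrite -fb (eqx b m (- x t)).
have {ln0}l0 : 0 < l by rewrite lt_neqAle eq_sym ln0.
have {mn0}m0 : 0 < m by rewrite lt_neqAle eq_sym mn0.
have lm0 : 0 < l + m by rewrite addr_gt0.
have lmn0 : l + m != 0 by rewrite gt_eqF.
(* Off [t], [a] is [x + l *: x t] and [b] is [x - m *: x t]; this weight gives
   [(1 - n) *: a + n *: b = x]. *)
pose n := l / (l + m).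
have n01 : 0 < n < 1 by rewrite divr_gt0//= ltr_pdivrMr// mul1r ltrDl.
have ab : `|b - a| <= l + m.
  apply: norm_le_contfun => [|k]; first exact: ltW.
  rewrite contfunBE; have [->|kt] := eqVneq k t.
    by rewrite at_ bt subrr normr0 ltW.
  rewrite aE// bE// opprD addrACA subrr add0r scalerN -opprD normrN -scalerDl.
  by rewrite normrZ xt1 mulr1 addrC ger0_norm// ltW.
have a_t1 : `|a t| = 1 by rewrite at_.
have abt : a t = b t by rewrite at_ bt.
have [z [z1 zt Dz]] := face_segment hK hdot hD a1 b1 a_t1 abt n01.
have <- : z = x.
  apply: contfun_ext => k; have [->|kt] := eqVneq k t; first by rewrite zt at_.
  have za : `|z k - a k| <= l.
    apply: le_trans (le_norm_contfun (z - a) k) _.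
    have -> : `|z - a| = `|D z - D a| by rewrite Di.
    have -> : D z - D a = n *: (D b - D a).
      by rewrite Dz scalerBl scale1r scalerBr addrC addrA addKr addrC.
    rewrite normrZ Di// ger0_norm; last by case/andP: n01 => /ltW.
    apply: le_trans (ler_wpM2l _ ab) _; first by case/andP: n01 => /ltW.
    by rewrite /n divfK.
  have zb : `|z k - b k| <= m.
    apply: le_trans (le_norm_contfun (z - b) k) _.
    have -> : `|z - b| = `|D z - D b| by rewrite Di.
    have -> : D z - D b = - ((1 - n) *: (D b - D a)).
      rewrite Dz scalerBr opprB -addrA; congr (_ + _).
      by rewrite scalerBl scale1r opprB.
    rewrite normrN normrZ Di// ger0_norm ?subr_ge0;
      last by case/andP: n01 => _ /ltW.
    apply: le_trans (ler_wpM2l _ ab) _; first by rewrite subr_ge0;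
      case/andP: n01 => _ /ltW.
    by rewrite mulrBl mul1r /n divfK// addrC addKr.
  apply/eqP; rewrite -subr_eq0; apply/eqP/sqr_norm_le0.
  move: za zb; rewrite aE// bE// !opprD !addrA scalerN opprK.
  move: (z k - x k) => d za zb.
  have sa : `|d - l *: x t| ^+ 2 <= l ^+ 2 by rewrite lerXn2r ?nnegrE// ltW.
  have sb : `|d + m *: x t| ^+ 2 <= m ^+ 2 by rewrite lerXn2r ?nnegrE// ltW.
  move: sa sb;
    rewrite -scaleNr !(normD_sqr hdot) !normrZ xt1 !mulr1 !real_normK
      ?num_real//.
  rewrite !(dotC dot d) !linearZl_LR/= sqrrN => sa sb.
  have sa' : `|d| ^+ 2 <= 2 * l * dot (x t) d by lra.
  have sb' : `|d| ^+ 2 <= - (2 * m * dot (x t) d) by lra.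
  (* The weights [m] and [l] cancel the inner products and leave [(l + m) * |d| ^+ 2 <= 0]. *)
  rewrite -(pmulr_rle0 _ lm0).
  have := ler_wpM2l (ltW m0) sa'; have := ler_wpM2l (ltW l0) sb'; lra.
have -> : f (D z) = (1 - n) * f (D a) + n * f (D b).
  by rewrite Dz linearD/=; congr (_ + _); exact: linearZ.
by rewrite fa fb zt at_; ring.
Qed.

(** If [x t] is [e] or [- e], both sides of (i) agree. Otherwise, with [u] constant of value [e],
    Day's theorem makes the norm quadratic on the span of [D u] and [D x], and [f], which is 1 at
    [D u] and below the norm, is its derivative there. *)
Lemma support_eval_point x : (forall k, k = t) -> `|x| = 1 ->
  f (D x) = dot (x t) e.
Proof.
move=> Kt x1.
have nE (y : C) : `|y| = `|y t|.
  apply/eqP; rewrite eq_le le_norm_contfun andbT.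
  by apply: norm_le_contfun => // k; rewrite (Kt k).
have bounds := fs.2 _ x1.
have [xe|xe] := eqVneq (x t) e.
  move: bounds; rewrite xe subrr normr0 subr0 -mulr2n normrMn e1.
  by rewrite -hdot e1 expr1n => /andP[h1 h2]; apply/eqP; rewrite eq_le;
    apply/andP; split; lra.
have [xe'|xe'] := eqVneq (x t) (- e).
  move: bounds; rewrite xe' opprK subrr normr0 -mulr2n normrMn e1.
  by rewrite linearNl/= -hdot e1 expr1n => /andP[h1 h2]; apply/eqP;
    rewrite eq_le; apply/andP; split; lra.
have [u uE] := contfun_cst cK e.
have u1 : `|u| = 1 by rewrite nE uE.
have rhombus (v w : Y) : `|v| = 1 -> `|w| = 1 ->
  `|v + w| ^+ 2 + `|v - w| ^+ 2 = 4.
  have [_ Ds _] := hD.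
  move=> /Ds[y y1 <-] /Ds[z z1 <-].
  have [z' z'1 Dz'] : exists2 z' : C, `|z'| = 1 & D z' = - D z.
    by apply: Ds; rewrite normrN D1.
  have z't : z' t = - z t by apply: (face_opp hK hdot hD z1 z'1 _ Dz');
    rewrite -nE.
  have -> : D y + D z = D y - D z' by rewrite Dz' opprK.
  rewrite !Di// !nE !contfunBE z't opprK.
  by rewrite (parallelogram hdot) -!nE y1 z1; lra.
have free (p q : R) : p *: D u + q *: D x = 0 -> p = 0 /\ q = 0.
  move=> pq; have [q0|q0] := eqVneq q 0.
    move/eqP: pq; rewrite q0 scale0r addr0 scaler_eq0 => /orP[/eqP //|].
    by rewrite -normr_eq0 D1// oner_eq0.
  exfalso.
  have DxE : D x = (- (p / q)) *: D u.
    apply: (scalerI q0); rewrite scalerA mulrN mulrCA divff// mulr1 scaleNr.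
    by apply/eqP; rewrite -subr_eq0 opprK addrC pq.
  have : `|- (p / q)| = 1 by rewrite -(D1 x1) DxE normrZ D1// mulr1.
  have uxD : D u != D x.
    rewrite -subr_eq0 -normr_eq0 Di// normr_eq0 subr_eq0.
    by apply/eqP => ux; rewrite -ux uE eqxx in xe.
  move/eqP; rewrite eqr_norml ler01 andbT => /orP[] /eqP k1.
    by move: uxD; rewrite DxE k1 scale1r eqxx.
  move/negP: xe'; apply; apply/eqP.
  rewrite -(uE t); apply: (face_opp hK hdot hD u1 x1); first by rewrite -nE.
  by rewrite DxE k1 scaleN1r.
have [M ME] := day_rhombus rhombus free.
have q1 := ME 1 0; have q2 := ME 0 1; have q3 := ME 1 1.
move: q1 q2 q3.
rewrite !scale1r !scale0r addr0 add0r !D1// /binary_form expr1n expr0n/=.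
have -> : `|D u + D x| ^+ 2 = 2 + 2 * dot (x t) e.
  have := rhombus _ _ (D1 u1) (D1 x1); rewrite Di// nE contfunBE uE.
  rewrite (normD_sqr hdot) normrN -(nE x) x1 e1 linearNr/= (dotC dot e); lra.
move=> q1 q2 q3.
have M1 : M.1.1 = 1 by lra.
have M2 : M.2 = 1 by lra.
have M12 : M.1.2 = dot (x t) e by lra.
have fu : f (D u) = 1.
  have := fs.2 _ u1; rewrite uE subrr normr0 subr0 -mulr2n normrMn e1.
  by move=> /andP[h1 h2]; apply/eqP; rewrite eq_le; apply/andP; split; lra.
(* Uses [n <= (1 + n ^+ 2) / 2] for the norm [n]; small [p] of either sign then compare the linear
   terms. *)
have key (p : R) : 1 + p * f (D x) <= 1 + p * dot (x t) e + p ^+ 2 / 2.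
  have : f (1 *: D u + p *: D x) <= `|1 *: D u + p *: D x| by exact: fs.1.
  rewrite linearD/= !linearZ/= fu mul1r.
  have := sqr_ge0 (`|1 *: D u + p *: D x| - 1).
  by rewrite sqrrB ME /binary_form M1 M2 M12; lra.
apply/eqP; rewrite eq_le; apply/andP; split; apply/ler_addgt0Pl => p p0.
  by rewrite -(ler_pM2l p0); have := key p; nra.
by rewrite -(ler_pM2l p0); have := key (- p); nra.
Qed.

Lemma support_eval x : `|x| = 1 -> f (D x) = dot (x t) e.
Proof.
move=> x1; have [xle [s xs1]] := (contfun_normP x).1 x1.
have [st|st] := eqVneq s t; last exact: (support_eval_off st).
rewrite st in xs1.
have [[k kt]|Kt] := pselect (exists k, k != t); last first.
  apply: support_eval_point => // k; apply: contrapT => /eqP kt.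
  by apply: Kt; exists k.
have [tiso|tlim] := pselect (nbhs t [set t]).
  exact: (support_eval_isolated _ _ _ kt).
exact: support_eval_limit_point.
Qed.

End evaluation_functionals.

(** * The linear extension *)

Theorem corollary5p7 (R : realType)
    (K : topologicalType) (cK : compact [set: K]) (hK : hausdorff_space K)
    (H : completeNormedModType R) (dot : {dot H for idfun})
    (hdot : forall x : H, `|x| ^+ 2 = dot x x)
    (hdim : even_dimensional H \/ infinite_dimensional H) :
  mazur_ulam_property (contfun cK H).
Proof.
move=> Y D Df Dsurj Diso.
have hD : sphere_isometry D.
  split=> [x x1|w w1|x y x1 y1].
  - exact: Df.
  - by have [x x1 xw] := Dsurj _ w1; exists x.
  - exact: Diso.
(* The positively homogeneous extension of [D]; the factor [|x|] gives the value 0 at 0. *)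
pose T (x : contfun cK H) : Y := `|x| *: D (`|x|^-1 *: x).
have unitize (V : normedModType R) (v : V) : v != 0 -> `| `|v|^-1 *: v| = 1.
  by move=> v0; rewrite normrZ normfV normr_id mulVf// normr_eq0.
have Tnorm x : `|T x| = `|x|.
  rewrite /T normrZ normr_id; have [->|x0] := eqVneq x 0.
    by rewrite normr0 mul0r.
  by have [D1 _ _] := hD; rewrite D1 ?mulr1// unitize.
have Tunit x : `|x| = 1 -> T x = D x.
  by move=> x1; rewrite /T x1 invr1 !scale1r.
have Teval t (e : H) (f : {scalar Y}) x : `|e| = 1 -> supports D f t e ->
    f (T x) = dot (x t) e.
  move=> e1 fs; have [->|x0] := eqVneq x 0.
    by rewrite /T normr0 scale0r linear0 linear0l.
  have xn0 : `|x| != 0 by rewrite normr_eq0.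
  rewrite linearZ/= (support_eval hK hdot hD e1 fs) ?unitize//.
  by rewrite contfunZE linearZl_LR/= mulrA divff// mul1r.
have Tsurj w : exists x, T x = w.
  have [->|w0] := eqVneq w 0; first by exists 0; rewrite /T normr0 scale0r.
  have [_ Ds _] := hD; have [x x1 Dx] := Ds _ (unitize _ _ w0).
  exists (`|w| *: x).
  rewrite /T normrZ normr_id x1 mulr1 scalerA mulVf ?normr_eq0// scale1r Dx.
  by rewrite scalerA divff ?normr_eq0// scale1r.
(* For [w = T x] and [x t != 0], the direction [e = x t / |x t|] gives the nonzero value [|x t|]. *)
have separated (w : Y) :
    (forall t e f, `|e| = 1 -> supports D f t e -> f w = 0) -> w = 0.
  have [x <-] := Tsurj w => w0; apply/eqP; rewrite -normr_eq0 Tnorm normr_eq0.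
  apply/eqP/contfun_ext => t; apply/eqP; rewrite -normr_eq0;
    apply/negPn/negP => xt0.
  have xtn0 : x t != 0 by rewrite -normr_eq0.
  have e1 := unitize _ _ xtn0.
  have [f fs] := exists_support hK hdot hD t e1.
  have := w0 _ _ _ e1 fs; rewrite (Teval _ _ _ _ e1 fs) linearZr_LR/= -hdot.
  by move/eqP; rewrite mulf_eq0 invr_eq0 expf_eq0/= (negPf xt0).
(* Each supporting functional sends [T x] to [dot (x t) e], linear in [x], and so annihilates the
   defect of linearity. *)
have Tl : linear T.
  move=> c x y; apply/eqP; rewrite -subr_eq0;
    apply/eqP/separated => t e f e1 fs.
  have fT := Teval _ _ _ _ e1 fs; rewrite linearB/= linearD/=.
  have -> : f (c *: T x) = c * f (T x) by exact: linearZ.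
  rewrite !fT.
  by rewrite contfunDE contfunZE linearDl/= linearZl_LR/= subrr.
pose L := HB.pack_for {linear contfun cK H -> Y} T
  (GRing.isLinear.Build R (contfun cK H) Y *:%R T Tl).
exists L; split=> [x y|w _|x x1].
- by rewrite -linearB; exact: Tnorm.
- by have [x xw] := Tsurj w; exists x.
- exact: Tunit.
Qed.
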